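(* Let $(\mathcal{M},\mathbf{g})$ be a compact two-dimensional Riemannian manifold without boundary, and let $\epsilon>0$. Then there exist a smooth function $f:\mathcal{M}\to\mathbb{R}$, an open subset $V\subset\mathcal{M}$, a constant $C>0$ and a real number $\alpha$ such that: (1) $\mathrm{vol}(V)\ge \mathrm{vol}(\mathcal{M})-\epsilon$; (2) $\inf_{x\in V}|\nabla f(x)|>0$; (3) for every $T>0$ and every $u\in C^1(\mathcal{M}\times[0,T])$, $$C\int_0^T\!\!\int_{V}\left(|\nabla u|^2+u_t^2\right)d\mathcal{M}\,dt\;\le\;\int_0^T\!\!\int_{V}\left[\mathrm{Hess} f(\nabla u,\nabla u)+\left(\alpha-\frac{\Delta f}{2}\right)|\nabla u|^2+\left(\frac{\Delta f}{2}-\alpha\right)u_t^2\right]d\mathcal{M}\,dt .$$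
   Context: The Riemannian metric $\mathbf{g}$ is of class $C^2$. Here $\nabla$ is the Riemannian gradient in the space variable $x\in\mathcal{M}$, $\mathrm{Hess} f$ is the Hessian of $f$ with respect to the Levi-Civita connection of $\mathbf{g}$, viewed as a symmetric bilinear form on each tangent space, $\Delta f$ is the Laplace-Beltrami operator of $f$ (the trace of $\mathrm{Hess} f$ with respect to $\mathbf{g}$), $d\mathcal{M}$ is the Riemannian measure, $\mathrm{vol}$ is the corresponding volume, and $u_t=\partial u/\partial t$. *)

(* Defs.v *)
From HB Require Import structures.
From mathcomp Require Import all_boot all_order all_algebra.
From mathcomp Require Import all_classical all_reals all_analysis.
Set Implicit Arguments.
Unset Strict Implicit.
Unset Printing Implicit Defensive.
Import Order.TTheory GRing.Theory Num.Theory.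
Import numFieldNormedType.Exports.
Local Open Scope classical_set_scope.
Local Open Scope ring_scope.

Definition coord2 (R : realType) (a : 'I_2) (x : R * R) : R :=
  if a == 0 then x.1 else x.2.

Definition ebasis (R : realType) (a : 'I_2) : R * R :=
  if a == 0 then (1, 0) else (0, 1).

Definition pderiv (R : realType) (a : 'I_2) (F : R * R -> R) : R * R -> R :=
  fun x => 'D_(ebasis R a) F x.

(* Only used for open D, where continuity at the points of D within D and
   within R^2 agree. *)
Fixpoint Ck (R : realType) (k : nat) (D : set (R * R)) (F : R * R -> R) : Prop :=
  (forall x, D x -> {for x, continuous F}) /\
  match k with
  | 0%N => True
  | k'.+1 => forall a : 'I_2,
      (forall x, D x -> derivable F x (ebasis R a)) /\ Ck k' D (pderiv a F)
  end.

Definition Cinfty (R : realType) (D : set (R * R)) (F : R * R -> R) : Prop :=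
  forall k, Ck k D F.

(* Homeomorphism from an open subset of M onto an open subset of R^2 (hence no
   boundary); the values of cmap outside cdom and of cinv outside the image
   are irrelevant. *)
Record chart (R : realType) (M : topologicalType) := Chart {
  cdom : set M;
  cmap : M -> R * R;
  cinv : R * R -> M;
  cdom_open : open cdom;
  cimg_open : open (cmap @` cdom);
  cmapK : forall p, cdom p -> cinv (cmap p) = p;
  cmap_continuous : {within cdom, continuous cmap};
  cinv_continuous : {within cmap @` cdom, continuous cinv}
}.

Definition cimg (R : realType) (M : topologicalType) (c : chart R M) :
  set (R * R) := cmap c @` cdom c.

Definition overlap (R : realType) (M : topologicalType) (c c' : chart R M) :
  set (R * R) := cmap c @` (cdom c `&` cdom c').

Definition transition (R : realType) (M : topologicalType) (c c' : chart R M)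
  (a : 'I_2) : R * R -> R := fun x => coord2 a (cmap c' (cinv c x)).

Definition jacobian (R : realType) (M : topologicalType) (c c' : chart R M)
  (x : R * R) : 'M[R]_2 := \matrix_(a, b) pderiv b (transition c c' a) x.

(* A Hausdorff topological surface with a smooth atlas and a metric of class
   C^2; the metric is given by its matrices of components in the charts, which
   are subject to the transformation law of covariant 2-tensors. *)
Record riemannian_surface (R : realType) (M : topologicalType) :=
  RiemannianSurface {
  atlas_index : Type;
  atlas : atlas_index -> chart R M;
  surface_hausdorff : hausdorff_space M;
  atlas_cover : forall p : M, exists i, cdom (atlas i) p;
  atlas_smooth : forall i j (a : 'I_2),
    Cinfty (overlap (atlas i) (atlas j)) (transition (atlas i) (atlas j) a);
  metric : atlas_index -> R * R -> 'M[R]_2;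
  metric_C2 : forall i (a b : 'I_2),
    Ck 2 (cimg (atlas i)) (fun x => metric i x a b);
  metric_sym : forall i x, cimg (atlas i) x -> (metric i x)^T = metric i x;
  metric_pos : forall i x, cimg (atlas i) x ->
    forall v : 'cV[R]_2, v != 0 -> 0 < (v^T *m metric i x *m v) 0 0;
  metric_change : forall i j x, overlap (atlas i) (atlas j) x ->
    metric i x =
    (jacobian (atlas i) (atlas j) x)^T
      *m metric j (cmap (atlas j) (cinv (atlas i) x))
      *m jacobian (atlas i) (atlas j) x
}.

Section Geometry.
Variables (R : realType) (M : topologicalType) (S : riemannian_surface R M).
Implicit Types (i : atlas_index S) (F : R * R -> R) (x : R * R) (f : M -> R) (p : M).

Definition smooth f : Prop :=
  forall i, Cinfty (cimg (atlas i)) (f \o cinv (atlas i)).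

Definition form_eval (A : 'M[R]_2) (v w : 'cV[R]_2) : R := (v^T *m A *m w) 0 0.

Definition differential F x : 'cV[R]_2 := \col_a pderiv a F x.

Definition gradient i F x : 'cV[R]_2 :=
  invmx (metric i x) *m differential F x.

(* Christoffel symbol of the Levi-Civita connection, with upper index c. *)
Definition christoffel i (c a b : 'I_2) x : R :=
  2^-1 * \sum_(d < 2) invmx (metric i x) c d *
    (pderiv a (fun y => metric i y b d) x
     + pderiv b (fun y => metric i y a d) x
     - pderiv d (fun y => metric i y a b) x).

(* Components of the covariant derivative of the 1-form dF. *)
Definition hessian i F x : 'M[R]_2 :=
  \matrix_(a, b) (pderiv a (pderiv b F) x
                  - \sum_(c < 2) christoffel i c a b x * pderiv c F x).

Definition laplacian i F x : R := \tr (invmx (metric i x) *m hessian i F x).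

(* The scalars below are computed in some chart around the point; by the
   transformation laws they do not depend on which one. *)
Definition chart_at p : atlas_index S := projT1 (cid (atlas_cover S p)).

Definition expr_at f p : R * R -> R := f \o cinv (atlas (chart_at p)).

Definition pt p : R * R := cmap (atlas (chart_at p)) p.

Definition grad_at f p : 'cV[R]_2 := gradient (chart_at p) (expr_at f p) (pt p).

(* |grad f|^2 *)
Definition sqgrad f p : R :=
  form_eval (metric (chart_at p) (pt p)) (grad_at f p) (grad_at f p).

(* |grad f| *)
Definition normgrad f p : R := Num.sqrt (sqgrad f p).

(* Hess f (grad u, grad u) *)
Definition hess_grad f (u : M -> R) p : R :=
  form_eval (hessian (chart_at p) (expr_at f p) (pt p)) (grad_at u p) (grad_at u p).

Definition laplace_beltrami f p : R :=
  laplacian (chart_at p) (expr_at f p) (pt p).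

(* Difference quotients of h at t inside [0, T], so that the derivatives at the
   endpoints are one-sided and h is not looked at outside [0, T]. *)
Definition time_quotient (T : R) (h : R -> R) (t : R) : set_system R :=
  (h s - h t) / (s - t) @[s --> within `[0, T] t^'].

Definition time_deriv (T : R) (h : R -> R) (t : R) : R :=
  lim (time_quotient T h t).

(* u is of class C^1 on M x [0, T] *)
Definition C1_cylinder (T : R) (u : M -> R -> R) : Prop :=
  forall i,
  let D := cimg (atlas i) `*` `[0, T] in
  let v x t := u (cinv (atlas i) x) t in
  [/\ forall x t, D (x, t) -> forall a, derivable (v ^~ t) x (ebasis R a),
      forall x t, D (x, t) -> cvg (time_quotient T (v x) t),
      {within D, continuous (fun z => v z.1 z.2)},
      forall a, {within D, continuous (fun z => pderiv a (v ^~ z.2) z.1)}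
    & {within D, continuous (fun z => time_deriv T (v z.1) z.2)}].

End Geometry.

Notation borel M := (g_sigma_algebraType (@open M)).

(* The Riemannian measure: the Borel measure with density sqrt (det g) with
   respect to Lebesgue measure in every chart.  These conditions determine it
   when M is compact, since finitely many charts then cover M. *)
Definition riemannian_measure (R : realType) (M : ptopologicalType)
    (S : riemannian_surface R M) (vol : {measure set (borel M) -> \bar R}) : Prop :=
  forall (i : atlas_index S) (A : set (borel M)),
    measurable A -> A `<=` cdom (atlas i) ->
    vol A = (\int[(@lebesgue_measure R \x @lebesgue_measure R)%E]_(x in
               cmap (atlas i) @` A) (Num.sqrt (\det (metric i x)))%:E)%E.

(* Main.v *)
Require Import Defs.
From HB Require Import structures.
From mathcomp Require Import all_boot all_order all_algebra.
From mathcomp Require Import all_classical all_reals all_analysis.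
From mathcomp Require Import ring lra.
Import Order.TTheory GRing.Theory Num.Theory.
Import numFieldNormedType.Exports.
Local Open Scope classical_set_scope.
Local Open Scope ring_scope.
Set Implicit Arguments.
Unset Strict Implicit.
Unset Printing Implicit Defensive.

(** Let mu1 <= mu2 be the eigenvalues of Hess f with respect to the metric at a
    point.  Since the surface has dimension two,
    Hess f (v, v) - (Delta f / 2) |v|^2 >= - ((mu2 - mu1) / 2) |v|^2, so the
    integrand of (3) dominates a multiple of |grad u|^2 + u_t^2 as soon as
    (mu2 - mu1) / 2 < alpha < (mu1 + mu2) / 2.  With alpha = 1/2 and C = 1/4 this
    holds wherever Hess f differs from the metric by at most ten percent
    ([pinched], [pinched_carleman]).  The inequality is then true point by point,
    for every tangent vector and every value of u_t, and it is integrated in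
    [iterated_integral_le].

    No function on a closed surface can have such a Hessian everywhere, but V may
    be disconnected, and near each point such functions exist: in a chart around
    y, take the quadratic polynomial whose second derivative is the metric
    matrix at y and whose critical point x0 is close to y.  Its gradient is small
    around y, so the Christoffel terms hardly change the Hessian, which stays
    near the metric.  Taking x0 outside a still smaller ball around y keeps
    the gradient away from zero on that ball ([pinched_quadratic_near]).

    By compactness finitely many such balls cover the surface.  They are treated
    one after the other ([exhausting_function]).  In the next ball, minus the
    support K of the function built so far, a finite union V' of coordinate boxes
    fills everything but a set of small volume; the local quadratic polynomial
    is multiplied by a smooth cutoff equal to 1 on V' and supported away from K
    ([local_piece]), and the product is added to the function.  The supports are
    disjoint, so near each point of V only one summand is nonzero.

    The scalars in the statement are computed at each point in a chart that may
    have nothing to do with the chart in which f was built.  Hence the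
    transformation laws [gradient_change] and [hessian_change]; the second one
    rests on the symmetry of second derivatives ([Ck2_pderivC]). *)

(** * Calculus of two variables *)

Lemma is_derive_line (R : realType) (V : normedModType R) (F : V -> R) (x v : V) (s : R) :
  derivable F (s *: v + x) v ->
  is_derive s 1 (fun s => F (s *: v + x)) ('D_v F (s *: v + x)).
Proof.
have E : (fun h : R => h^-1 *: (F ((h *: (1 : R^o) + s) *: v + x) - F (s *: v + x)))
  = (fun h : R => h^-1 *: (F (h *: v + (s *: v + x)) - F (s *: v + x))).
  by apply/funext => h; rewrite [X in (X + s) *: _]mulr1 scalerDl addrA.
move=> dF; split; last by rewrite /derive E.
by rewrite /derivable E.
Qed.

Lemma mean_value_line (R : realType) (V : normedModType R) (F : V -> R)
    (x v : V) (t : R) :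
  (forall s : R, `|s| <= `|t| -> derivable F (s *: v + x) v) ->
  exists2 s : R, `|s| <= `|t| & F (t *: v + x) - F x = t * 'D_v F (s *: v + x).
Proof.
move=> dF; pose g s := F (s *: v + x).
have g0 : F x = g 0 by rewrite /g scale0r add0r.
have dg (s : R) : `|s| <= `|t| -> is_derive s 1 g ('D_v F (s *: v + x)).
  by move=> /dF; exact: is_derive_line.
have cg (a b : R) : `|a| <= `|t| -> `|b| <= `|t| -> {within `[a, b], continuous g}.
  move=> at_ bt; apply: derivable_within_continuous => s; rewrite in_itv/= => /andP[as_ sb].
  apply: ex_derive; apply: dg; move: at_ bt; rewrite !ler_norml; lra.
have [t0|t0] := leP 0 t.
  have [||s] := @MVT_segment R g (fun s => 'D_v F (s *: v + x)) 0 t t0.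
  - by move=> s; rewrite in_itv/= => /andP[? ?]; apply: dg; rewrite ger0_norm ?ger0_norm// ltW.
  - by apply: cg; rewrite ?normr0.
  rewrite in_itv/= => /andP[s0 st] E; exists s; first by rewrite !ger0_norm.
  by rewrite g0 E subr0 mulrC.
have [||s] := @MVT_segment R g (fun s => 'D_v F (s *: v + x)) t 0 (ltW t0).
- move=> s; rewrite in_itv/= => /andP[? ?]; apply: dg.
  by rewrite !ler0_norm ?lerN2// ltW.
- by apply: cg; rewrite ?normr0.
rewrite in_itv/= => /andP[st s0] E; exists s; first by rewrite !ler0_norm ?lerN2// ltW.
by rewrite g0 -opprB E; ring.
Qed.

Lemma ord2_ind (P : 'I_2 -> Prop) : P 0 -> P 1 -> forall a, P a.
Proof.
move=> P0 P1 a; case: (splitP (a : 'I_(1 + 1))) => j; rewrite !ord1/= => aj.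
  by have -> : a = 0 by exact/val_inj.
by have -> : a = 1 by exact/val_inj.
Qed.

(** Differentiability comes with the identification of the differential, which
    is what the chain rule below needs. *)
Lemma differentiable_of_remainder (K : realType) (V W : normedModType K)
    (f : V -> W) (L : {linear V -> W}) (x : V) : continuous L ->
  (forall e : K, 0 < e ->
    \forall h \near (0 : V), `|f (h + x) - (f x + L h)| <= e * `|h|) ->
  differentiable f x /\ 'd f x = L :> (V -> W).
Proof.
move=> cL H.
have E : f \o shift x = cst (f x) + L +o_ 0 id.
  by apply/eqaddoP => e e0; exact: H.
have D := diff_unique cL E; split=> //.
by apply/diff_locallyP; rewrite D.
Qed.

(** Continuous partial derivatives give a total differential: the increment is
    split along the two coordinate directions, and the mean value theorem on each
    segment replaces it by a partial derivative at a nearby point. *)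
Lemma differentiable_of_partials (R : realType) (F : R * R -> R) (x : R * R) :
  (forall a, \forall y \near x, derivable F y (ebasis R a)) ->
  (forall a, {for x, continuous (pderiv a F)}) ->
  differentiable F x /\
  'd F x = (fun h => h.1 * pderiv 0 F x + h.2 * pderiv 1 F x) :> (R * R -> R).
Proof.
move=> dF cF.
pose L (h : R * R) : R := h.1 * pderiv 0 F x + h.2 * pderiv 1 F x.
have linL : linear L.
  by move=> k y z; rewrite /L /= /GRing.scale/=; ring.
pose Lm := GRing.isLinear.Build _ _ _ _ _ linL.
pose LL : {linear (R * R)%type -> R} := HB.pack L Lm.
have cL : continuous LL.
  move=> y; apply: (@cvgD _ R^o); apply: (@cvgM R).
  - exact: cvg_fst.
  - exact: cvg_cst.
  - exact: cvg_snd.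
  - exact: cvg_cst.
apply: (@differentiable_of_remainder R (R * R)%type R F LL x cL) => e e0.
  have e20 : 0 < e / 2 by rewrite divr_gt0.
  have N a : \forall y \near x, derivable F y (ebasis R a) /\
      `|pderiv a F x - pderiv a F y| < e / 2.
    near=> y; split; near: y; first exact: dF.
    by move: (cF a) => /cvgrPdist_lt; apply.
  have [d /= d0 H] : exists2 d : R, 0 < d & forall y, ball x d y -> forall a,
      derivable F y (ebasis R a) /\ `|pderiv a F x - pderiv a F y| < e / 2.
    have /nbhs_ballP [d1 /= d10 H1] := (N 0).
    have /nbhs_ballP [d2 /= d20 H2] := (N 1).
    exists (Num.min d1 d2); first by rewrite lt_min d10.
    move=> y xy; apply: ord2_ind; [apply: H1|apply: H2]; apply: le_ball xy;
      by rewrite ge_min lexx ?orbT.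
  apply/nbhs_ballP; exists d => //= h.
  rewrite /ball/= /prod_ball/= !/ball/= !sub0r !normrN => -[h1 h2].
  have xE : h + x = h.2 *: ebasis R 1 + (h.1 *: ebasis R 0 + x).
    rewrite [h]surjective_pairing [x]surjective_pairing /ebasis/=.
    by congr pair; rewrite /GRing.scale/= /GRing.scale/=; ring.
  have B s t : `|s| <= `|h.1| -> `|t| <= `|h.2| ->
     ball x d (t *: ebasis R 1 + (s *: ebasis R 0 + x)).
    rewrite /ball/= /prod_ball/= /ball/= /GRing.scale/= => sh th.
    split; rewrite distrC.
      rewrite [X in `|X|](_ : _ = s); first exact: le_lt_trans sh h1.
      by rewrite /GRing.scale/=; ring.
    rewrite [X in `|X|](_ : _ = t); first exact: le_lt_trans th h2.
    by rewrite /GRing.scale/=; ring.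
  have h20 : `|0 : R| <= `|h.2| by rewrite normr0.
  have Z (y : R * R) : 0 *: ebasis R 1 + y = y by rewrite scale0r add0r.
  have [|s sh Es] := @mean_value_line R _ F x (ebasis R 0) h.1.
    by move=> s sh; have [] := H _ (B s 0 sh h20) 0; rewrite Z.
  have [|t th Et] := @mean_value_line R _ F (h.1 *: ebasis R 0 + x) (ebasis R 1) h.2.
    by move=> t th; have [] := H _ (B h.1 t _ th) 1.
  have [_ P0] := H _ (B s 0 sh h20) 0.
  have [_ P1] := H _ (B h.1 t (lexx _) th) 1.
  rewrite Z in P0.
  rewrite xE.
  set A := F _ in Et *. set A1 := F _ in Es Et *. set A2 := F _ in Es *.
  have -> : A - (A2 + LL h) = h.1 * (pderiv 0 F (s *: ebasis R 0 + x) - pderiv 0 F x)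
     + h.2 * (pderiv 1 F (t *: ebasis R 1 + (h.1 *: ebasis R 0 + x)) - pderiv 1 F x).
    rewrite (_ : A = A - A1 + (A1 - A2) + A2); last by ring.
    by rewrite Et Es /pderiv /=; rewrite /L /pderiv; ring.
  rewrite (le_trans (ler_normD _ _))// !normrM.
  have h1n : `|h.1| <= `|h| by rewrite prod_normE le_max lexx.
  have h2n : `|h.2| <= `|h| by rewrite prod_normE le_max lexx orbT.
  rewrite [leRHS](_ : _ = `|h| * (e / 2) + `|h| * (e / 2)); last by field.
  by apply: lerD; apply: ler_pM => //; rewrite distrC ltW.
Unshelve. all: by end_near. Qed.

Section Ck_theory.
Context {R : realType}.
Implicit Types (D : set (R * R)) (F G : R * R -> R) (x : R * R) (a : 'I_2).

Lemma CkS k D F : Ck k.+1 D F -> Ck k D F.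
Proof.
elim: k F => [|k IH] F [cF dF]; split=> // a.
by have [d1 d2] := dF a; split=> //; exact: IH.
Qed.

Lemma Ck_continuous k D F x : Ck k D F -> D x -> {for x, continuous F}.
Proof. by case: k => [|k] [cF _] Dx; exact: cF. Qed.

Lemma Ck_derivable k D F x a : Ck k.+1 D F -> D x -> derivable F x (ebasis R a).
Proof. by move=> [_ /(_ a)[dF _]]; exact: dF. Qed.

Lemma Ck_pderiv k D F a : Ck k.+1 D F -> Ck k D (pderiv a F).
Proof. by move=> [_ /(_ a)[]]. Qed.

(** The class C^k is a local property.  A function on the surface that is given
    by different formulas on different open sets is shown smooth in this way. *)
Lemma Ck_local k D F : (forall x, D x -> exists2 D', D' x & Ck k D' F) -> Ck k D F.
Proof.
elim: k F => [|k IH] F H; split=> //.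
- by move=> x /H[D' D'x] /Ck_continuous; exact.
- by move=> x /H[D' D'x] /Ck_continuous; exact.
move=> a; split=> [x /H[D' D'x] /Ck_derivable|]; first exact.
by apply: IH => x /H[D' D'x] /Ck_pderiv; exists D'.
Qed.

Lemma Ck_sub k D D' F : D' `<=` D -> Ck k D F -> Ck k D' F.
Proof. by move=> sD CF; apply: Ck_local => x /sD Dx; exists D. Qed.

Lemma near_pderiv F G a x : (\near x, F x = G x) -> pderiv a F x = pderiv a G x.
Proof. exact: near_eq_derive. Qed.

Lemma eq_pderiv D F G a : open D -> {in D, F =1 G} -> {in D, pderiv a F =1 pderiv a G}.
Proof.
move=> oD FG x /[!inE] Dx; apply: near_pderiv; near=> y.
by apply: FG; rewrite inE; near: y; exact: open_nbhs_nbhs.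
Unshelve. all: by end_near. Qed.

Lemma eq_Ck k D F G : open D -> {in D, F =1 G} -> Ck k D F -> Ck k D G.
Proof.
move=> oD; elim: k F G => [|k IH] F G FG CF.
all: have nFG x : D x -> \near x, F x = G x by
  move=> Dx; apply: filterS (open_nbhs_nbhs (conj oD Dx)) => y Dy; apply: FG; rewrite inE.
all: have cG x : D x -> {for x, continuous G} by
  move=> Dx; rewrite /prop_for /continuous_at -(FG x) ?inE//;
  apply: cvg_trans (Ck_continuous CF Dx); exact/near_eq_cvg/nFG.
  by split.
split=> // a; split=> [x Dx|].
  by apply: near_eq_derivable; [exact: nFG|exact: Ck_derivable CF Dx].
by apply: IH (Ck_pderiv a CF); exact: eq_pderiv.
Qed.

Lemma pderiv_cst (c : R) a x : pderiv a (fun=> c) x = 0.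
Proof. exact: derive_cst. Qed.

Lemma Ck_cst k D (c : R) : Ck k D (fun=> c).
Proof.
elim: k c => [|k IH] c; split=> //.
- by move=> x _; exact: cst_continuous.
- by move=> x _; exact: cst_continuous.
move=> a; split=> [x _|]; first exact: derivable_cst.
by rewrite (_ : pderiv _ _ = fun=> 0) //; apply/funext => x; rewrite pderiv_cst.
Qed.

Lemma CkD k D F G : open D -> Ck k D F -> Ck k D G -> Ck k D (fun x => F x + G x).
Proof.
move=> oD; elim: k F G => [|k IH] F G CF CG.
all: have cS x : D x -> {for x, continuous (fun x => F x + G x)} by
  move=> Dx; apply: (@cvgD _ R^o); [exact: Ck_continuous CF Dx|exact: Ck_continuous CG Dx].
  by split.
split=> // a; split=> [x Dx|].
  exact: (derivableD (Ck_derivable CF Dx) (Ck_derivable CG Dx)).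
apply: eq_Ck (IH _ _ (Ck_pderiv a CF) (Ck_pderiv a CG)) => // x /[!inE] Dx.
exact: (esym (deriveD (Ck_derivable CF Dx) (Ck_derivable CG Dx))).
Qed.

Lemma pderivM F G a x : derivable F x (ebasis R a) -> derivable G x (ebasis R a) ->
  pderiv a (fun x => F x * G x) x = F x * pderiv a G x + G x * pderiv a F x.
Proof. exact: deriveM. Qed.

Lemma CkM k D F G : open D -> Ck k D F -> Ck k D G -> Ck k D (fun x => F x * G x).
Proof.
move=> oD; elim: k F G => [|k IH] F G CF CG.
all: have cS x : D x -> {for x, continuous (fun x => F x * G x)} by
  move=> Dx; apply: (@cvgM R); [exact: Ck_continuous CF Dx|exact: Ck_continuous CG Dx].
  by split.
split=> // a; split=> [x Dx|].
  exact: (derivableM (Ck_derivable CF Dx) (Ck_derivable CG Dx)).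
apply: (@eq_Ck _ D (fun x => F x * pderiv a G x + G x * pderiv a F x)) => //.
  by move=> x /[!inE] Dx; rewrite pderivM//; [exact: Ck_derivable CF Dx|exact: Ck_derivable CG Dx].
by apply: CkD => //; apply: IH; solve [exact: CkS|exact: Ck_pderiv].
Qed.

Lemma CkV k D F : open D -> (forall x, D x -> F x != 0) -> Ck k D F ->
  Ck k D (fun x => (F x)^-1).
Proof.
move=> oD F0; elim: k => [|k IH] CF.
all: have cS x : D x -> {for x, continuous (fun x => (F x)^-1)} by
  move=> Dx; apply: cvgV; [exact: F0|exact: Ck_continuous CF Dx].
  by split.
split=> // a; split=> [x Dx|].
  apply: derivableV; [exact: F0|exact: (Ck_derivable CF Dx)].
apply: (@eq_Ck _ D (fun x => -1 * ((F x)^-1 * (F x)^-1) * pderiv a F x)) => //.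
  move=> x /[!inE] Dx; rewrite [RHS]deriveV ?F0//; last exact: Ck_derivable CF Dx.
  by rewrite /GRing.scale/= mulN1r expr2 invfM.
have CV := IH (CkS CF).
by do ! apply: CkM => //; [exact: Ck_cst|exact: Ck_pderiv].
Qed.

Lemma Ck_differentiable k D F x : open D -> Ck k.+1 D F -> D x ->
  differentiable F x /\
  'd F x = (fun h => h.1 * pderiv 0 F x + h.2 * pderiv 1 F x) :> (R * R -> R).
Proof.
move=> oD CF Dx; apply: differentiable_of_partials => a.
  apply: filterS (open_nbhs_nbhs (conj oD Dx)) => y; exact: Ck_derivable CF.
exact: (Ck_continuous (Ck_pderiv a CF) Dx).
Qed.

(** The chain rule for F (p, q), in the only form used here: both the outer
    function and the inner pair are functions on the plane. *)
Lemma pderiv_comp k l D D' F (p q : R * R -> R) a x : open D -> open D' ->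
  Ck k.+1 D' F -> Ck l.+1 D p -> Ck l.+1 D q ->
  D x -> D' (p x, q x) ->
  derivable (fun y => F (p y, q y)) x (ebasis R a) /\
  pderiv a (fun y => F (p y, q y)) x =
   pderiv 0 F (p x, q x) * pderiv a p x + pderiv 1 F (p x, q x) * pderiv a q x.
Proof.
move=> oD oD' CF Cp Cq Dx D'x.
have [dF EF] := Ck_differentiable oD' CF D'x.
have [dp Ep] := Ck_differentiable oD Cp Dx.
have [dq Eq] := Ck_differentiable oD Cq Dx.
have dpq := differentiable_pair dp dq.
have dc : differentiable (F \o (fun y => (p y, q y))) x by exact: differentiable_comp.
split; first exact: diff_derivable.
rewrite /pderiv deriveE// diff_comp//= EF diff_pair//= -!deriveE// /pderiv.
by ring.
Qed.

Lemma continuous_comp_pair F (p q : R * R -> R) x :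
  {for x, continuous p} -> {for x, continuous q} ->
  {for (p x, q x), continuous F} -> {for x, continuous (fun y => F (p y, q y))}.
Proof.
move=> cp cq cF; apply: (@continuous_comp _ _ _ (fun x => (p x, q x)) F) => //.
exact: (@cvg_pair _ _ _ _ (nbhs (p x)) (nbhs (q x)) _ _ _ p q).
Qed.

Lemma Ck_comp k D D' F (p q : R * R -> R) : open D -> open D' ->
  (forall x, D x -> D' (p x, q x)) ->
  Ck k D' F -> Ck k D p -> Ck k D q -> Ck k D (fun x => F (p x, q x)).
Proof.
move=> oD oD' DD'; elim: k F => [|k IH] F CF Cp Cq.
all: have cS x : D x -> {for x, continuous (fun x => F (p x, q x))} by
  move=> Dx; exact: (continuous_comp_pair (Ck_continuous Cp Dx)
    (Ck_continuous Cq Dx) (Ck_continuous CF (DD' _ Dx))).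
  by split.
split=> // a; split=> [x Dx|].
  by have [] := pderiv_comp a oD oD' CF Cp Cq Dx (DD' _ Dx).
apply: (@eq_Ck _ D (fun x => pderiv 0 F (p x, q x) * pderiv a p x
   + pderiv 1 F (p x, q x) * pderiv a q x)) => //.
  move=> x /[!inE] Dx.
  by have [_ ->] := pderiv_comp a oD oD' CF Cp Cq Dx (DD' _ Dx).
by apply: CkD => //; apply: CkM => //; solve [exact: Ck_pderiv|
  apply: (IH _ (Ck_pderiv _ CF)); exact: CkS].
Qed.

End Ck_theory.

(** The mean value theorem, applied first in direction u to the difference in
    direction v and then in direction v, computes the second difference.  Its
    left-hand side is symmetric in u and v, which yields the symmetry of second
    derivatives. *)
Lemma second_difference (R : realType) (V : normedModType R) (F : V -> R)
    (x u v : V) (h : R) :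
  (forall s t : R, `|s| <= `|h| -> `|t| <= `|h| ->
     derivable F (t *: v + (s *: u + x)) u /\
     derivable ('D_u F) (t *: v + (s *: u + x)) v) ->
  exists s t : R, [/\ `|s| <= `|h|, `|t| <= `|h| &
    F (h *: v + (h *: u + x)) - F (h *: u + x) - F (h *: v + x) + F x =
    h * (h * 'D_v ('D_u F) (t *: v + (s *: u + x)))].
Proof.
move=> dF; pose G y := F (h *: v + y) - F y.
have h0 : `|0 : R| <= `|h| by rewrite normr0.
have shiftE y : 0 *: v + y = y by rewrite scale0r add0r.
have dFh (s : R) : `|s| <= `|h| -> is_derive (s *: u + x) u (fun y => F (h *: v + y))
    ('D_u F (h *: v + (s *: u + x))).
  move=> sh; have [dh _] := dF s h sh (lexx _).
  have E : (fun k : R => k^-1 *: (F (h *: v + (k *: u + (s *: u + x))) - F (h *: v + (s *: u + x))))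
      = (fun k : R => k^-1 *: (F (k *: u + (h *: v + (s *: u + x))) - F (h *: v + (s *: u + x)))).
    by apply/funext => k; rewrite addrCA.
  by split; [rewrite /derivable E|rewrite /derive E].
have dF0 (s : R) : `|s| <= `|h| -> derivable F (s *: u + x) u.
  by move=> sh; have [] := dF s 0 sh h0; rewrite shiftE.
have [s sh|s sh E1] := @mean_value_line R V G x u h.
  by apply: derivableB; [apply: ex_derive; exact: dFh|exact: dF0].
have [t th|t th E2] := @mean_value_line R V ('D_u F) (s *: u + x) v h.
  by have [] := dF s t sh th.
exists s, t; split=> //; rewrite -E2.
transitivity (G (h *: u + x) - G x); first by rewrite /G; ring.
have dh := dFh s sh.
by rewrite E1 deriveB ?derive_val//; exact: dF0.
Qed.

(** If the two mixed derivatives differed at x, continuity would keep them apart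
    near x; but both are equal to the same second difference, divided by the
    square of the step, at points arbitrarily close to x. *)
Lemma Ck2_pderivC (R : realType) (D : set (R * R)) (F : R * R -> R) (x : R * R)
    (a b : 'I_2) : open D -> Ck 2 D F -> D x ->
  pderiv a (pderiv b F) x = pderiv b (pderiv a F) x.
Proof.
move=> oD CF Dx; apply/eqP; rewrite -subr_eq0; apply/negPn/negP => ne.
set e := `|pderiv a (pderiv b F) x - pderiv b (pderiv a F) x| / 2.
have e0 : 0 < e by rewrite divr_gt0// normr_gt0.
have cont c d : \forall y \near x,
    `|pderiv c (pderiv d F) x - pderiv c (pderiv d F) y| < e.
  have : {for x, continuous (pderiv c (pderiv d F))}.
    by apply: Ck_continuous Dx; exact: (Ck_pderiv c (Ck_pderiv d CF)).
  by move/cvgrPdist_lt; apply.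
have : \forall y \near x, [/\ D y,
    `|pderiv a (pderiv b F) x - pderiv a (pderiv b F) y| < e &
    `|pderiv b (pderiv a F) x - pderiv b (pderiv a F) y| < e].
  by apply: filterS3 (open_nbhs_nbhs (conj oD Dx)) (cont a b) (cont b a) => y; split.
move=> /nbhs_ballP[r /= r0 H].
(* Two coordinate steps of length h stay in the ball of radius r. *)
pose h := r / 3.
have hE : `|h| = h by rewrite ger0_norm// divr_ge0// ltW.
have hr : h + h < r by clear -r0; rewrite /h; lra.
have B c d (s t : R) : `|s| <= `|h| -> `|t| <= `|h| ->
    ball x r (t *: ebasis R c + (s *: ebasis R d + x)).
  rewrite hE => sh th; rewrite -ball_normE /ball_/= distrC addrA addrK.
  have nb c' : `|ebasis R c'| <= 1.
    by move: c'; apply: ord2_ind; rewrite prod_normE /ebasis/= normr1 normr0 ge_max lexx ler01.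
  rewrite (le_lt_trans (ler_normD _ _))// !normrZ.
  have As := ler_pM (normr_ge0 s) (normr_ge0 _) sh (nb d).
  have At := ler_pM (normr_ge0 t) (normr_ge0 _) th (nb c).
  by rewrite (le_lt_trans (lerD At As))// !mulr1.
have main c d : exists s t : R, [/\ `|s| <= `|h|, `|t| <= `|h| &
    F (h *: ebasis R c + (h *: ebasis R d + x)) - F (h *: ebasis R d + x)
      - F (h *: ebasis R c + x) + F x =
    h * (h * pderiv c (pderiv d F) (t *: ebasis R c + (s *: ebasis R d + x)))].
  apply: second_difference => s t sh th; have [Dy _ _] := H _ (B c d s t sh th).
  by split; [exact: Ck_derivable CF Dy|exact: Ck_derivable (Ck_pderiv d CF) Dy].
have [s [t [sh th E1]]] := main a b.
have [s' [t' [sh' th' E2]]] := main b a.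
have [_ N1 _] := H _ (B a b _ _ sh th).
have [_ _ N2] := H _ (B b a _ _ sh' th').
have E : h * (h * pderiv a (pderiv b F) (t *: ebasis R a + (s *: ebasis R b + x))) =
    h * (h * pderiv b (pderiv a F) (t' *: ebasis R b + (s' *: ebasis R a + x))).
  by rewrite -E1 -E2 [h *: ebasis R a + (h *: _ + x)]addrCA; ring.
have h0 : h != 0 by rewrite /h mulf_neq0// gt_eqF.
move/(mulfI h0)/(mulfI h0) : E => E; rewrite -E in N2.
have := ltrD N1 N2; rewrite [X in _ + X]distrC.
have /le_lt_trans le := ler_distD (pderiv a (pderiv b F) (t *: ebasis R a + (s *: ebasis R b + x)))
   (pderiv a (pderiv b F) x) (pderiv b (pderiv a F) x).
by move/le; rewrite /e -splitr ltxx.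
Qed.

(** * Smooth cutoff functions *)

Section flat.
Context {R : realType}.
Implicit Types (t : R) (x : R * R).

(** The functions t^(-n) exp (- 1 / t), extended by zero to t <= 0.  The whole
    family is needed because it is closed under differentiation up to linear
    combinations, which gives smoothness by induction. *)
Definition flat (n : nat) (t : R) : R :=
  if 0 < t then t^-1 ^+ n * expR (- t^-1) else 0.

Lemma flat_ge0 n t : 0 <= flat n t.
Proof.
rewrite /flat; case: ifP => // t0; apply: mulr_ge0; last exact: expR_ge0.
by rewrite exprn_ge0// invr_ge0 ltW.
Qed.

Lemma flatS n t : flat n t = t * flat n.+1 t.
Proof.
rewrite /flat; case: ifPn => [t0|]; last by rewrite mulr0.
by rewrite exprS !mulrA mulfV ?gt_eqF// mul1r.
Qed.

(** From exp s >= (1 + s / m)^m with m = n + 1 and s = 1 / t. *)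
Lemma flat_le n t : `|flat n t| <= (n.+1%:R ^+ n.+1) * `|t|.
Proof.
rewrite ger0_norm ?flat_ge0//; have [t0|t0] := ltP 0 t; last first.
  by rewrite /flat ltNge t0/= mulr_ge0// exprn_ge0.
rewrite flatS mulrC gtr0_norm// ler_wpM2r ?(ltW t0)// /flat t0.
rewrite expRN -(ler_pM2r (expR_gt0 t^-1)) -mulrA mulVf ?gt_eqF ?expR_gt0// mulr1.
have tn : 0 <= t^-1 / n.+1%:R by rewrite divr_ge0// invr_ge0 ltW.
have -> : expR t^-1 = expR (t^-1 / n.+1%:R) ^+ n.+1.
  by rewrite -expRM_natl; congr expR; rewrite mulrC divfK.
rewrite -exprMn; apply: lerXn2r; rewrite ?nnegrE ?invr_ge0 ?(ltW t0)//.
by rewrite -ler_pdivrMl// mulrC (le_trans _ (expR_ge1Dx _))// lerDr.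
Qed.

Lemma flat_continuous0 n : {for 0, continuous (flat n)}.
Proof.
have f0 : flat n 0 = 0 by rewrite /flat ltxx.
have e1 (e : R) : 0 < e -> 0 < e / n.+1%:R ^+ n.+1.
  by move=> e0; rewrite divr_gt0// exprn_gt0.
apply/cvgrPdist_lt => e e0.
have N : \forall t \near (0 : R), `|t| < e / n.+1%:R ^+ n.+1 := nbhs0_lt (e1 _ e0).
apply: filterS N => t te.
by rewrite f0 sub0r normrN (le_lt_trans (flat_le n t))// mulrC -ltr_pdivlMr ?exprn_gt0.
Qed.

(** At t = 0 the difference quotient of the n-th function is the (n + 1)-st one,
    which tends to zero. *)
Lemma is_derive_flat n t :
  is_derive t 1 (flat n) (- n%:R * flat n.+1 t + flat n.+2 t).
Proof.
have [t0|t0|->] := ltgtP t 0.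
- have E : \near t, (fun=> 0) t = flat n t.
    near=> s; rewrite /flat ltNge ltW//; near: s; exact: lt_nbhsl.
  apply: near_eq_is_derive E _; rewrite /flat !ltNge ltW//= mulr0 addr0.
  exact: is_derive_cst.
- have E : \near t, (fun s => s^-1 ^+ n * expR (- s^-1)) t = flat n t.
    near=> s; rewrite /flat (_ : 0 < s)//; near: s; exact: lt_nbhsr.
  apply: near_eq_is_derive E _.
  have dV : is_derive t 1 (fun s : R => s^-1) (- t^-2).
    split; first by apply: derivableV; [rewrite gt_eqF|exact: derivable_id].
    by rewrite deriveV ?gt_eqF// derive_id /GRing.scale/= mulr1.
  have dE : is_derive t 1 (fun s : R => expR (- s^-1)) (expR (- t^-1) * t^-2).
    apply: (@is_derive1_comp _ expR (fun s => - s^-1)).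
    by have := is_deriveN dV; rewrite opprK.
  have dX : is_derive t 1 (fun s : R => s^-1 ^+ n) (n%:R * t^-1 ^+ n.-1 * - t^-2).
    by have := is_deriveX n dV; rewrite exprfctE.
  apply: is_derive_eq (is_deriveM dX dE) _.
  rewrite /flat t0 /GRing.scale/=; case: (n) => [|m] /=.
    by rewrite !mul0r oppr0 mul0r mulr0 addr0 add0r expr0 -exprVn; ring.
  by rewrite -exprVn !exprS; ring.
- have -> : - n%:R * flat n.+1 0 + flat n.+2 0 = 0 :> R.
    by rewrite /flat ltxx mulr0 addr0.
  have f0 m : flat m 0 = 0 by rewrite /flat ltxx.
  have H : (fun h : R => h^-1 *: (flat n (h *: (1 : R^o) + 0) - flat n 0)) @ 0^' --> flat n.+1 0.
    have /continuous_withinNx := flat_continuous0 (n := n.+1).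
    apply: cvg_trans; apply: near_eq_cvg.
    have N : \forall h \near (0 : R)^', h != 0 := nbhs_dnbhs_neq _.
    apply: filterS N => h h0.
    rewrite addr0 [h *: 1]mulr1 f0 subr0 (flatS n).
    by rewrite /GRing.scale/= mulrA mulVf// mul1r.
  rewrite (f0 n.+1) in H.
  by split; [apply/cvg_ex; exists 0|apply: cvg_lim H; exact: norm_hausdorff].
Unshelve. all: by end_near. Qed.

Lemma is_derive_coord1 (g : R -> R) x a d :
  is_derive x.1 (ebasis R a).1 g d -> is_derive x (ebasis R a) (fun y => g y.1) d.
Proof. by case=> g1 g2; split. Qed.

Lemma is_derive_coord2 (g : R -> R) x a d :
  is_derive x.2 (ebasis R a).2 g d -> is_derive x (ebasis R a) (fun y => g y.2) d.
Proof. by case=> g1 g2; split. Qed.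

Lemma Ck_coord1 k D : @Ck R k D fst.
Proof.
have cf x : D x -> {for x, continuous (fst : R * R -> R)} by move=> _; exact: cvg_fst.
case: k => [|k]; split=> // a.
have df x : is_derive x (ebasis R a) (fst : R * R -> R) (ebasis R a).1.
  by apply: (@is_derive_coord1 id).
split=> [x _|]; first exact: ex_derive.
rewrite (_ : pderiv a _ = fun=> (ebasis R a).1); first exact: Ck_cst.
by apply/funext => x; rewrite /pderiv derive_val.
Qed.

Lemma Ck_coord2 k D : @Ck R k D snd.
Proof.
have cf x : D x -> {for x, continuous (snd : R * R -> R)} by move=> _; exact: cvg_snd.
case: k => [|k]; split=> // a.
have df x : is_derive x (ebasis R a) (snd : R * R -> R) (ebasis R a).2.
  by apply: (@is_derive_coord2 id).
split=> [x _|]; first exact: ex_derive.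
rewrite (_ : pderiv a _ = fun=> (ebasis R a).2); first exact: Ck_cst.
by apply/funext => x; rewrite /pderiv derive_val.
Qed.

(** These functions of one variable are seen as functions on the plane so that
    one notion of class C^k serves everywhere. *)
Lemma Ck_flat k n : Ck k setT (fun x => flat n x.1).
Proof.
elim: k n => [|k IH] n.
all: have cf x : setT x -> {for x, continuous (fun x => flat n x.1)} by
  move=> _; apply: (@continuous_comp _ _ _ fst (flat n)); [exact: cvg_fst|
  apply: differentiable_continuous; apply/derivable1_diffP; apply: ex_derive;
  exact: is_derive_flat].
  by split.
split=> //; apply: ord2_ind; split=> [x _|].
- by apply: ex_derive; apply: is_derive_coord1; exact: is_derive_flat.
- rewrite (_ : pderiv _ _ = fun x => - n%:R * flat n.+1 x.1 + flat n.+2 x.1).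
    by apply: CkD => //; [exact: openT|apply: CkM => //; [exact: openT|exact: Ck_cst]].
  apply/funext => x; rewrite /pderiv; apply: derive_val; apply: is_derive_coord1.
  exact: is_derive_flat.
- by apply: ex_derive; apply: is_derive_coord1; exact: is_derive0.
rewrite (_ : pderiv _ _ = fun=> 0); first exact: Ck_cst.
apply/funext => x; rewrite /pderiv; apply: derive_val; apply: is_derive_coord1.
exact: is_derive0.
Qed.

End flat.

Section box_bump.
Context {R : realType}.
Implicit Types (t r : R) (c x : R * R).

Definition smooth_step t : R := flat 0 t / (flat 0 t + flat 0 (1 - t)).

Lemma smooth_step_denom_gt0 t : 0 < flat 0 t + flat 0 (1 - t).
Proof.
have pos s : 0 < s -> 0 < flat 0 s.
  by move=> s0; rewrite /flat s0 mulr_gt0 ?expR_gt0// exprn_gt0// invr_gt0.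
have [t0|t0] := ltP 0 t; first by rewrite ltr_wpDr ?flat_ge0 ?pos.
by rewrite ltr_wpDl ?flat_ge0 ?pos//; lra.
Qed.

Lemma smooth_step1 t : 1 <= t -> smooth_step t = 1.
Proof.
move=> t1; rewrite /smooth_step; have := smooth_step_denom_gt0 t.
have -> : flat 0 (1 - t) = 0 by rewrite /flat ltNge subr_le0 t1.
by rewrite addr0 => ?; rewrite divff// gt_eqF.
Qed.

Lemma smooth_step0 t : t <= 0 -> smooth_step t = 0.
Proof. by move=> t0; rewrite /smooth_step /flat ltNge t0 mul0r. Qed.

Lemma Ck_smooth_step k : Ck k setT (fun x => smooth_step x.1).
Proof.
have oT : open [set: R * R] by exact: openT.
have Cf : Ck k setT (fun x : R * R => flat 0 x.1) := Ck_flat k 0.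
have C1 : Ck k setT (fun x : R * R => flat 0 (1 - x.1)).
  apply: (@Ck_comp _ k setT setT (fun x => flat 0 x.1) (fun x => 1 - x.1) (fun=> 0)) => //.
    apply: (@CkD _ k setT (fun=> 1) (fun x => - x.1)) => //; first exact: Ck_cst.
    apply: (@eq_Ck _ k setT (fun x => (-1) * x.1)) => //.
      by move=> x _; rewrite mulN1r.
    by apply: CkM => //; [exact: Ck_cst|exact: Ck_coord1].
  exact: Ck_cst.
apply: CkM => //; apply: CkV => //; last exact: CkD.
by move=> x _; rewrite gt_eqF// smooth_step_denom_gt0.
Qed.

(** The argument of the step is at least 1 when |t| <= r and at most 0 when
    |t| >= 2 r; squaring avoids the corner of the absolute value. *)
Definition coord_bump (t r : R) : R := smooth_step ((4 - (t / r) ^+ 2) / 3).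

Definition box_bump c r x : R := coord_bump (x.1 - c.1) r * coord_bump (x.2 - c.2) r.

Lemma coord_bump1 t r : `|t| <= r -> coord_bump t r = 1.
Proof.
move=> tr; apply: smooth_step1.
have r0 : 0 <= r := le_trans (normr_ge0 t) tr.
suff : (t / r) ^+ 2 <= 1 by lra.
rewrite -real_normK ?num_real// exprn_ile1// normrM normfV (ger0_norm r0).
move: r0; rewrite le_eqVlt => /orP[/eqP <-|r0]; first by rewrite invr0 mulr0.
by rewrite ler_pdivrMr// mul1r.
Qed.

Lemma coord_bump0 t r : 0 < r -> 2 * r <= `|t| -> coord_bump t r = 0.
Proof.
move=> r0 tr; apply: smooth_step0.
suff : 2 ^+ 2 <= (t / r) ^+ 2 by lra.
rewrite -[leRHS]real_normK ?num_real// lerXn2r ?nnegrE//.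
by rewrite normrM normfV (gtr0_norm r0) ler_pdivlMr.
Qed.

Lemma box_bump1 c r x : `|x - c| <= r -> box_bump c r x = 1.
Proof.
rewrite prod_normE ge_max => /andP[x1 x2].
by rewrite /box_bump !coord_bump1// mulr1.
Qed.

Lemma box_bump0 c r x : 0 < r -> 2 * r <= `|x - c| -> box_bump c r x = 0.
Proof.
move=> r0; rewrite prod_normE le_max => /orP[x1|x2].
  by rewrite /box_bump coord_bump0// mul0r.
by rewrite /box_bump [X in _ * X]coord_bump0// mulr0.
Qed.

Lemma Ck_coord_bump k D r (p : R * R -> R) : open D -> Ck k D p ->
  Ck k D (fun x => coord_bump (p x) r).
Proof.
move=> oD Cp.
have Cq : Ck k D (fun x => p x / r) by apply: CkM => //; exact: Ck_cst.
apply: (@Ck_comp _ k D setT (fun x => smooth_step x.1)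
  (fun x => (4 - (p x / r) ^+ 2) / 3) (fun=> 0)) => //.
- exact: openT.
- exact: Ck_smooth_step.
- apply: (@eq_Ck _ k D (fun x => (4 + (-1) * ((p x / r) * (p x / r))) / 3)) => //.
    by move=> x _; rewrite mulN1r expr2.
  by do ! [exact: Ck_cst|exact: Cq|apply: CkM => //|apply: CkD => //].
- exact: Ck_cst.
Qed.

Lemma Ck_box_bump k D c r : open D -> Ck k D (box_bump c r).
Proof.
move=> oD; apply: CkM => //; apply: Ck_coord_bump => //; apply: CkD => //;
  by [exact: Ck_coord1|exact: Ck_coord2|exact: Ck_cst].
Qed.

End box_bump.

(** * Symmetric positive definite matrices of size two *)

Section two_by_two.
Context {R : realType}.
Implicit Types (A B g h J H : 'M[R]_2) (v w : 'cV[R]_2).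

Lemma sum2 (F : 'I_2 -> R) : \sum_(i < 2) F i = F 0 + F 1.
Proof.
rewrite !big_ord_recl big_ord0 addr0; congr (_ + F _); exact/val_inj.
Qed.

Lemma cveq2 v w : v 0 0 = w 0 0 -> v 1 0 = w 1 0 -> v = w.
Proof. by move=> *; apply/matrixP; apply: ord2_ind => j; rewrite ord1. Qed.

Let lift00 : lift 0 0 = 1 :> 'I_2. Proof. exact/val_inj. Qed.
Let lift10 : lift 1 0 = 0 :> 'I_2. Proof. exact/val_inj. Qed.

Lemma det2 A : \det A = A 0 0 * A 1 1 - A 0 1 * A 1 0.
Proof.
rewrite (expand_det_row _ 0) sum2 /cofactor !det_mx11 !mxE /=.
by rewrite !lift00 !lift10; ring.
Qed.

Lemma invmx2 A (a b : 'I_2) : A \in unitmx ->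
  invmx A a b = (\det A)^-1 *
    (if a == b then A (1 - a) (1 - b) else - A a b).
Proof.
move=> uA; rewrite /invmx uA 2!mxE /cofactor det_mx11 !mxE.
by move: a b; apply: ord2_ind; apply: ord2_ind => /=;
  rewrite ?lift00 ?lift10 ?subr0 ?subrr /=; ring.
Qed.

Lemma form2 A v w : form_eval A v w =
  v 0 0 * (A 0 0 * w 0 0 + A 0 1 * w 1 0) + v 1 0 * (A 1 0 * w 0 0 + A 1 1 * w 1 0).
Proof. by rewrite /form_eval -mulmxA mxE sum2 !mxE !sum2. Qed.

Definition posdef g := g^T = g /\ forall v, v != 0 -> 0 < (v^T *m g *m v) 0 0.

Lemma posdef_sym g : posdef g -> g 1 0 = g 0 1.
Proof. by move=> [gT _]; rewrite -{1}gT mxE. Qed.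

Lemma posdef00 g : posdef g -> 0 < g 0 0.
Proof.
move=> [_ gp]; pose v : 'cV[R]_2 := \col_i (if i == 0 then 1 else 0).
have := gp v; rewrite -/(form_eval g v v) form2 !mxE/= !(mulr0, mulr1, addr0, mul0r, mul1r).
apply; apply/eqP => /matrixP /(_ 0 0); rewrite !mxE/= => /eqP.
by rewrite oner_eq0.
Qed.

Lemma posdef_det g : posdef g -> 0 < \det g.
Proof.
move=> pg; have g00 := posdef00 pg; have g10 := posdef_sym pg; case: pg => _ gp.
pose v : 'cV[R]_2 := \col_i (if i == 0 then - g 0 1 else g 0 0).
have := gp v; rewrite -/(form_eval g v v) form2 !mxE/= => gv.
rewrite -(pmulr_rgt0 _ g00) det2.
have -> : g 0 0 * (g 0 0 * g 1 1 - g 0 1 * g 1 0) = - g 0 1 * (g 0 0 * - g 0 1 + g 0 1 * g 0 0) +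
         g 0 0 * (g 1 0 * - g 0 1 + g 1 1 * g 0 0) by rewrite g10; ring.
apply: gv; apply/eqP => /matrixP /(_ 1 0); rewrite !mxE/= => /eqP.
by rewrite gt_eqF.
Qed.

Lemma posdef_unit g : posdef g -> g \in unitmx.
Proof. by move=> pg; rewrite unitmxE unitfE gt_eqF// posdef_det. Qed.

Lemma posdef11 g : posdef g -> 0 < g 1 1.
Proof.
move=> pg; have g00 := posdef00 pg; have := posdef_det pg.
rewrite det2 (posdef_sym pg) -[0 < g 1 1](pmulr_rgt0 _ g00) => dg.
by have := sqr_ge0 (g 0 1); rewrite expr2; lra.
Qed.

Lemma posdef_ge0 g v : posdef g -> 0 <= form_eval g v v.
Proof.
move=> [_ gp]; have [->|v0] := eqVneq v 0; first by rewrite form2 !mxE; lra.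
exact/ltW/gp.
Qed.

Lemma mxtrace2 A : \tr A = A 0 0 + A 1 1.
Proof. exact: sum2. Qed.

(** By Cayley-Hamilton, tr g *: g = g *m g + (det g)%:M, and the form of g *m g
    at v is a sum of squares. *)
Lemma posdef_coercive g v : posdef g ->
  \det g / \tr g * (v 0 0 ^+ 2 + v 1 0 ^+ 2) <= form_eval g v v.
Proof.
move=> pg; have := posdef11 pg; have := posdef00 pg; have := posdef_sym pg.
rewrite mxtrace2 det2 form2 => -> g0 g1.
rewrite mulrAC ler_pdivrMr ?addr_gt0//.
have := sqr_ge0 (g 0 0 * v 0 0 + g 0 1 * v 1 0).
have := sqr_ge0 (g 0 1 * v 0 0 + g 1 1 * v 1 0).
rewrite !expr2; move: (g 0 0) (g 0 1) (g 1 1) (v 0 0) (v 1 0) => a b c x y.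
clear; lra.
Qed.

(** The factors 9/10 and 11/10 leave room for alpha = 1/2 and C = 1/4 in
    [pinched_carleman]. *)
Definition pinched g H := forall v,
  9 / 10 * form_eval g v v <= form_eval H v v <= 11 / 10 * form_eval g v v.

(** With w = (g 0 1, - g 0 0) and e = (1, 0), the trace of g^-1 H times
    (det g) (g 0 0) is H (w, w) + (det g) H (e, e); the same identity for H = g
    gives the value 2. *)
Lemma pinched_trace g H : posdef g -> pinched g H ->
  9 / 5 <= \tr (invmx g *m H) <= 11 / 5.
Proof.
move=> pg gH; have dg := posdef_det pg; have g00 := posdef00 pg.
have ug := posdef_unit pg; have g10 := posdef_sym pg.
have D0 : 0 < \det g * g 0 0 by rewrite mulr_gt0.
pose w : 'cV[R]_2 := \col_i (if i == 0 then g 0 1 else - g 0 0).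
pose e : 'cV[R]_2 := \col_i (if i == 0 then 1 else 0).
have E : \tr (invmx g *m H) * (\det g * g 0 0) =
    form_eval H w w + \det g * form_eval H e e.
  rewrite mxtrace2 !mxE !sum2 !invmx2//= !subr0 !subrr !form2 !mxE/= g10 mulrA.
  rewrite [LHS](_ : _ = (\det g * (\det g)^-1) * g 0 0 *
    (g 1 1 * H 0 0 - g 0 1 * H 1 0 + (- g 0 1 * H 0 1 + g 0 0 * H 1 1))).
    by rewrite divff ?gt_eqF// det2 g10; ring.
  by ring.
have Ew : form_eval g w w = \det g * g 0 0.
  by rewrite form2 det2 !mxE/= g10; ring.
have Ee : form_eval g e e = g 0 0.
  by rewrite form2 !mxE/=; ring.
have /andP[w1 w2] := gH w; have /andP[e1 e2] := gH e.
rewrite Ew in w1 w2; rewrite Ee in e1 e2.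
rewrite -(ler_pM2r D0) -[X in _ && X](ler_pM2r D0) E.
have e1' := ler_wpM2l (ltW dg) e1; have e2' := ler_wpM2l (ltW dg) e2.
move: (form_eval H w w) (form_eval H e e) w1 w2 e1' e2' => a b.
move: (\det g) (g 0 0) => d c; clear; lra.
Qed.

(** The pointwise form of inequality (3): tr / 2 lies in [9/10, 11/10], so the
    coefficients of |v|^2 and of s^2 are at least 3/10 and 2/5. *)
Lemma pinched_carleman g H v (s : R) : posdef g -> pinched g H ->
  let tr := \tr (invmx g *m H) in
  1 / 4 * (form_eval g v v + s ^+ 2) <= form_eval H v v
    + (1 / 2 - tr / 2) * form_eval g v v + (tr / 2 - 1 / 2) * s ^+ 2.
Proof.
move=> pg gH /=; have /andP[t1 t2] := pinched_trace pg gH.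
have /andP[h1 _] := gH v; have gv := posdef_ge0 v pg; have s0 := sqr_ge0 s.
move: (\tr _) t1 t2 => t t1 t2.
have A : 0 <= (11 / 5 - t) * form_eval g v v by rewrite mulr_ge0// subr_ge0.
have B : 0 <= (t - 9 / 5) * s ^+ 2 by rewrite mulr_ge0// subr_ge0.
move: (form_eval H v v) (form_eval g v v) (s ^+ 2) h1 gv s0 A B => a b c.
clear; lra.
Qed.

End two_by_two.

(** * Change of charts *)

(** The transformation law of the covariant derivative of a 1-form at a point,
    with all derivatives as independent unknowns: K stands for the derivatives of
    the metric components h in the target chart, L for the second derivatives of
    the transition map, J for its Jacobian matrix, GG for the second derivatives
    of the function, v for its gradient, and dg is what the product and chain rules
    give for the derivatives of the metric components J^T h J in the source chart.
    Contracting the Christoffel symbols with the gradient avoids the inverse of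
    the metric, which makes this a polynomial identity. *)
Lemma hessian_change_algebra (R : realType) (h J : 'M[R]_2) (v : 'cV[R]_2)
    (K L : 'I_2 -> 'I_2 -> 'I_2 -> R) (GG : 'I_2 -> 'I_2 -> R) (a b : 'I_2) :
  h 1 0 = h 0 1 -> (forall m, K m 1 0 = K m 0 1) -> (forall c, L c 1 0 = L c 0 1) ->
  let w := J *m v in
  let dg a b d := \sum_k \sum_l ((\sum_m K m k l * J m a) * J k b * J l d
     + h k l * L k a b * J l d + h k l * J k b * L l a d) in
  \sum_c ((\sum_d GG d c * J d a) * J c b + (h *m w) c 0 * L c a b)
   - 2^-1 * \sum_d v d 0 * (dg a b d + dg b a d - dg d a b) =
  \sum_n (\sum_m J m a * (GG m n
     - 2^-1 * \sum_l w l 0 * (K m n l + K n m l - K l m n))) * J n b.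
Proof.
move=> hs Ks Ls /=; rewrite !sum2 !mxE !sum2 !mxE !sum2.
move: (Ks 0) (Ks 1) (Ls 0) (Ls 1) => K0 K1 L0 L1.
by move: a b; apply: ord2_ind; apply: ord2_ind; rewrite hs ?K0 ?K1 ?L0 ?L1;
  field.
Qed.

Section charts.
Context {R : realType} {M : topologicalType}.
Implicit Types (c : chart R M) (x : R * R) (p : M).

Lemma cimg_cmap c p : cdom c p -> cimg c (cmap c p).
Proof. by exists p. Qed.

Lemma cdom_cinv c x : cimg c x -> cdom c (cinv c x).
Proof. by move=> [p cp <-]; rewrite cmapK. Qed.

Lemma cinvK c x : cimg c x -> cmap c (cinv c x) = x.
Proof. by move=> [p cp <-]; rewrite cmapK. Qed.

Lemma cinv_continuous_at c x : cimg c x -> {for x, continuous (cinv c)}.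
Proof.
move=> cx; have := @cinv_continuous R M c.
rewrite continuous_open_subspace; last exact: cimg_open.
by apply; rewrite inE.
Qed.

Lemma cmap_continuous_at c p : cdom c p -> {for p, continuous (cmap c)}.
Proof.
move=> cp; have := @cmap_continuous R M c.
rewrite continuous_open_subspace; last exact: cdom_open.
by apply; rewrite inE.
Qed.

Lemma near_cimg c x : cimg c x -> \forall y \near x, cimg c y.
Proof. by move=> cx; apply: open_nbhs_nbhs; split=> //; exact: cimg_open. Qed.

Lemma near_cdom c p : cdom c p -> \forall q \near p, cdom c q.
Proof. by move=> cp; apply: open_nbhs_nbhs; split=> //; exact: cdom_open. Qed.

Lemma overlapP c c' x : overlap c c' x <-> cimg c x /\ cdom c' (cinv c x).
Proof.
split; first by move=> [p [cp c'p] <-]; rewrite cmapK//; split=> //; exact: cimg_cmap.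
by move=> [cx c'x]; exists (cinv c x); [split=> //; exact: cdom_cinv|exact: cinvK].
Qed.

Lemma overlap_open c c' : open (overlap c c').
Proof.
rewrite openE => x /overlapP[cx c'x].
have N1 := near_cimg cx.
have N2 : \forall y \near x, cdom c' (cinv c y).
  by apply: (cinv_continuous_at cx); exact: near_cdom.
by apply: filterS2 N1 N2 => y cy c'y; apply/overlapP.
Qed.

End charts.

Lemma congruence_entry (R : realType) (h J : 'M[R]_2) (b d : 'I_2) :
  (J^T *m h *m J) b d =
    h 0 0 * J 0 b * J 0 d + h 0 1 * J 0 b * J 1 d
    + (h 1 0 * J 1 b * J 0 d + h 1 1 * J 1 b * J 1 d).
Proof. by rewrite !mxE !sum2 !mxE !sum2 !mxE; ring. Qed.

Section chart_change.
Context {R : realType} {M : topologicalType} (S : riemannian_surface R M).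
Variables i j : atlas_index S.
Implicit Types (x : R * R) (F : R * R -> R) (a b : 'I_2).

Local Notation O := (overlap (atlas i) (atlas j)).
Local Notation T := (fun x => (transition (atlas i) (atlas j) 0 x,
                               transition (atlas i) (atlas j) 1 x)).
Local Notation J := (Defs.jacobian (atlas i) (atlas j)).

Lemma transitionE x : T x = cmap (atlas j) (cinv (atlas i) x).
Proof. by rewrite /transition /coord2/= -surjective_pairing. Qed.

Lemma cimg_transition x : O x -> cimg (atlas j) (T x).
Proof. by move=> /overlapP[_ jx]; rewrite transitionE; exact: cimg_cmap. Qed.

Lemma Ck_transition k a : Ck k O (transition (atlas i) (atlas j) a).
Proof. exact: atlas_smooth. Qed.

Lemma pderiv_change k F x a : Ck k.+1 (cimg (atlas j)) F -> O x ->
  derivable (fun y => F (T y)) x (ebasis R a) /\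
  pderiv a (fun y => F (T y)) x = \sum_c pderiv c F (T x) * J x c a.
Proof.
move=> CF Ox; rewrite sum2 !mxE.
exact: (pderiv_comp a (@overlap_open _ _ (atlas i) (atlas j)) (@cimg_open _ _ (atlas j))
  CF (Ck_transition k.+1 0) (Ck_transition k.+1 1) Ox (cimg_transition Ox)).
Qed.

Lemma Ck_change k F : Ck k (cimg (atlas j)) F -> Ck k O (fun y => F (T y)).
Proof.
move=> CF; exact: (Ck_comp (@overlap_open _ _ (atlas i) (atlas j)) (@cimg_open _ _ (atlas j))
  cimg_transition CF (Ck_transition k 0) (Ck_transition k 1)).
Qed.

Lemma Ck_jacobian k a b : Ck k O (fun x => J x a b).
Proof.
have := Ck_pderiv b (Ck_transition k.+1 a).
by apply: eq_Ck; [exact: overlap_open|move=> x _; rewrite mxE].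
Qed.

Lemma metric_posdef (l : atlas_index S) x : cimg (atlas l) x -> posdef (metric l x).
Proof. by move=> lx; split; [exact: (Defs.metric_sym lx)|exact: (metric_pos lx)]. Qed.

Variable f : M -> R.
Local Notation Fi := (f \o cinv (atlas i)).
Local Notation Fj := (f \o cinv (atlas j)).

Lemma expression_change x : O x -> Fi x = Fj (T x).
Proof. by move=> /overlapP[_ jx]; rewrite /= transitionE cmapK. Qed.

Lemma eq_pderiv_overlap F G x a : (forall y, O y -> F y = G y) -> O x ->
  pderiv a F x = pderiv a G x.
Proof.
move=> FG Ox; have oO : open O by exact: overlap_open.
apply: (eq_pderiv a oO); last by rewrite inE.
by move=> y /[!inE]; exact: FG.
Qed.

Lemma differential_change x : Ck 1 (cimg (atlas j)) Fj -> O x ->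
  differential Fi x = (J x)^T *m differential Fj (T x).
Proof.
move=> Cf Ox; apply/matrixP => a o; rewrite ord1 !mxE.
rewrite (eq_pderiv_overlap a expression_change Ox).
have [_ ->] := pderiv_change a Cf Ox.
by apply: eq_bigr => c _; rewrite !mxE mulrC.
Qed.

(** The metric in the source chart is invertible and is a product of matrices one
    of which is the Jacobian matrix. *)
Lemma jacobian_unit x : O x -> J x \in unitmx.
Proof.
move=> Ox; have [ix jx] := (iffLR (overlapP _ _ _) Ox).
have := posdef_unit (metric_posdef ix); rewrite (metric_change Ox).
by rewrite !unitmx_mul => /andP[].
Qed.

Lemma metric_changeT x : O x -> metric i x = (J x)^T *m metric j (T x) *m J x.
Proof. by move=> Ox; rewrite (metric_change Ox) transitionE. Qed.

Lemma gradient_change x : Ck 1 (cimg (atlas j)) Fj -> O x ->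
  J x *m gradient i Fi x = gradient j Fj (T x).
Proof.
move=> Cf Ox; have [ix jx] := (iffLR (overlapP _ _ _) Ox).
have ui := posdef_unit (metric_posdef ix).
have uj := posdef_unit (metric_posdef (cimg_transition Ox)).
have uJ := jacobian_unit Ox.
rewrite /gradient differential_change//.
apply: (can_inj (mulKmx uj)); rewrite mulKVmx//.
have uJT : (J x)^T \in unitmx by rewrite unitmx_tr.
apply: (can_inj (mulKmx uJT)).
by rewrite mulmxA (mulmxA _ (J x)) -metric_changeT// mulKVmx.
Qed.

Lemma metric_form_change x v w : O x ->
  form_eval (metric i x) v w = form_eval (metric j (T x)) (J x *m v) (J x *m w).
Proof. by move=> Ox; rewrite /form_eval metric_changeT// trmx_mul !mulmxA. Qed.

Lemma metric_pderiv_change x a b d : O x ->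
  pderiv a (fun y => metric i y b d) x =
  \sum_k \sum_l ((\sum_m pderiv m (fun y => metric j y k l) (T x) * J x m a)
       * J x k b * J x l d
     + metric j (T x) k l * pderiv a (fun y => J y k b) x * J x l d
     + metric j (T x) k l * J x k b * pderiv a (fun y => J y l d) x).
Proof.
move=> Ox.
have E y : O y -> metric i y b d =
    metric j (T y) 0 0 * J y 0 b * J y 0 d + metric j (T y) 0 1 * J y 0 b * J y 1 d
    + (metric j (T y) 1 0 * J y 1 b * J y 0 d + metric j (T y) 1 1 * J y 1 b * J y 1 d).
  by move=> Oy; rewrite (metric_changeT Oy) congruence_entry.
rewrite (eq_pderiv_overlap a E Ox).
have dh k l := pderiv_change a (metric_C2 j k l) Ox.
have dJ (k m : 'I_2) : derivable (fun y => J y k m) x (ebasis R a).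
  exact: (Ck_derivable (Ck_jacobian 1 k m) Ox).
have dM F G : derivable F x (ebasis R a) -> derivable G x (ebasis R a) ->
   derivable (fun y => F y * G y) x (ebasis R a) by exact: derivableM.
have dt k l : derivable (fun y => metric j (T y) k l * J y k b * J y l d) x (ebasis R a).
  have [d1 _] := dh k l; exact: (dM _ _ (dM _ _ d1 (dJ k b)) (dJ l d)).
have dD F G : derivable F x (ebasis R a) -> derivable G x (ebasis R a) ->
   derivable (fun y => F y + G y) x (ebasis R a) /\
   pderiv a (fun y => F y + G y) x = pderiv a F x + pderiv a G x.
  by move=> dF dG; split; [exact: derivableD|exact: deriveD].
have tE k l : pderiv a (fun y => metric j (T y) k l * J y k b * J y l d) x =
   (\sum_m pderiv m (fun y => metric j y k l) (T x) * J x m a)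
       * J x k b * J x l d
     + metric j (T x) k l * pderiv a (fun y => J y k b) x * J x l d
     + metric j (T x) k l * J x k b * pderiv a (fun y => J y l d) x.
  have [d1 E1] := dh k l.
  rewrite (pderivM (dM _ _ d1 (dJ k b)) (dJ l d)) (pderivM d1 (dJ k b)) E1.
  by ring.
have [d1 E1] := dD _ _ (dt 0 0) (dt 0 1).
have [d2 E2] := dD _ _ (dt 1 0) (dt 1 1).
have [_ ->] := dD _ _ d1 d2.
by rewrite E1 E2 !tE !sum2.
Qed.

End chart_change.

Section hessian_change.
Context {R : realType} {M : topologicalType} (S : riemannian_surface R M).
Implicit Types (x : R * R) (F : R * R -> R) (a b : 'I_2).

(** The inverse metric in the Christoffel symbols raises the index of the
    differential, so that only the gradient is left. *)
Lemma christoffel_contract (i : atlas_index S) F x a b : cimg (atlas i) x ->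
  \sum_c christoffel i c a b x * pderiv c F x =
  2^-1 * \sum_d gradient i F x d 0 *
    (pderiv a (fun y => metric i y b d) x + pderiv b (fun y => metric i y a d) x
     - pderiv d (fun y => metric i y a b) x).
Proof.
move=> ix; have gs := posdef_sym (metric_posdef ix).
have iE c d : invmx (metric i x) c d = invmx (metric i x) d c.
  have /matrixP/(_ d c) : (invmx (metric i x))^T = invmx (metric i x).
    by rewrite trmx_inv (Defs.metric_sym ix).
  by rewrite mxE.
rewrite /christoffel /gradient !sum2 [(_ *m _) 0 0]mxE [(_ *m _) 1 0]mxE.
rewrite !sum2 ![differential _ _ _ _]mxE (iE 1 0).
by move: (invmx _) => g; ring.
Qed.

Section overlap.
Variables (i j : atlas_index S) (f : M -> R).
Local Notation O := (overlap (atlas i) (atlas j)).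
Local Notation T := (fun x => (transition (atlas i) (atlas j) 0 x,
                               transition (atlas i) (atlas j) 1 x)).
Local Notation J := (Defs.jacobian (atlas i) (atlas j)).
Local Notation Fi := (f \o cinv (atlas i)).
Local Notation Fj := (f \o cinv (atlas j)).

Lemma pderiv2_change x a b : Ck 2 (cimg (atlas j)) Fj -> O x ->
  pderiv a (pderiv b Fi) x =
  \sum_c ((\sum_d pderiv d (pderiv c Fj) (T x) * J x d a) * J x c b
    + pderiv c Fj (T x) * pderiv a (fun y => J y c b) x).
Proof.
move=> Cf Ox.
have E y : O y -> pderiv b Fi y =
    pderiv 0 Fj (T y) * J y 0 b + pderiv 1 Fj (T y) * J y 1 b.
  move=> Oy; rewrite (eq_pderiv_overlap b (@expression_change _ _ S i j f) Oy).
  by have [_ ->] := pderiv_change b Cf Oy; rewrite sum2.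
rewrite (eq_pderiv_overlap a E Ox).
have dF c := pderiv_change a (Ck_pderiv c Cf) Ox.
have dJ (c : 'I_2) : derivable (fun y => J y c b) x (ebasis R a).
  exact: (Ck_derivable (@Ck_jacobian _ _ S i j 1 c b) Ox).
have tE c : derivable (fun y => pderiv c Fj (T y) * J y c b) x (ebasis R a) /\
  pderiv a (fun y => pderiv c Fj (T y) * J y c b) x =
   (\sum_d pderiv d (pderiv c Fj) (T x) * J x d a) * J x c b
    + pderiv c Fj (T x) * pderiv a (fun y => J y c b) x.
  have [d1 E1] := dF c.
  split; first exact: (derivableM d1 (dJ c)).
  by rewrite (pderivM d1 (dJ c)) E1; ring.
have [d0 E0] := tE 0; have [d1 E1] := tE 1.
by rewrite sum2 -E0 -E1; exact: (deriveD d0 d1).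
Qed.

(** Both sides are reduced to first-kind Christoffel symbols contracted with the
    gradient, where [hessian_change_algebra] applies. *)
Lemma hessian_change x : Ck 2 (cimg (atlas j)) Fj -> O x ->
  hessian i Fi x = (J x)^T *m hessian j Fj (T x) *m J x.
Proof.
move=> Cf Ox; have [ix _] := (iffLR (overlapP _ _ _) Ox).
have jx := cimg_transition Ox.
have C1 := CkS Cf.
have wE := gradient_change C1 Ox.
have dGE c : pderiv c Fj (T x) = (metric j (T x) *m (J x *m gradient i Fi x)) c 0.
  rewrite wE /gradient mulKVmx ?posdef_unit//; last exact: metric_posdef.
  by rewrite mxE.
have oj : open (cimg (atlas j)) by exact: cimg_open.
apply/matrixP => a b.
rewrite [LHS]mxE christoffel_contract// pderiv2_change//.
under eq_bigr do rewrite dGE.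
under [X in _ - 2^-1 * X]eq_bigr do rewrite !(metric_pderiv_change _ _ _ Ox).
rewrite (@hessian_change_algebra R (metric j (T x)) (J x) (gradient i Fi x)
  (fun m k l => pderiv m (fun y => metric j y k l) (T x))
  (fun k a b => pderiv a (fun y => J y k b) x)
  (fun d c => pderiv d (pderiv c Fj) (T x))).
- rewrite [RHS]mxE; apply: eq_bigr => n _; congr (_ * _).
  rewrite [RHS]mxE; apply: eq_bigr => m _; congr (_ * _); first by rewrite [RHS]mxE.
  by rewrite [RHS]mxE christoffel_contract// wE.
- exact: posdef_sym (metric_posdef jx).
- move=> m; apply: (eq_pderiv m oj); last by rewrite inE.
  by move=> y /[!inE] jy; exact: posdef_sym (metric_posdef jy).
- move=> c; have oO : open O by exact: overlap_open.
  have E (a' b' : 'I_2) : pderiv a' (fun y => J y c b') x =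
     pderiv a' (pderiv b' (transition (atlas i) (atlas j) c)) x.
    by apply: (eq_pderiv a' oO); rewrite ?inE// => y _; rewrite mxE.
  rewrite !E; exact: Ck2_pderivC oO (@Ck_transition _ _ S i j _ _) Ox.
Qed.

End overlap.
End hessian_change.

(** * Pointwise properties of functions on the surface *)

Section pointwise.
Context {R : realType} {M : topologicalType} (S : riemannian_surface R M).
Implicit Types (f u : M -> R) (p : M) (i j : atlas_index S).

Lemma cdom_chart_at p : cdom (atlas (chart_at S p)) p.
Proof. exact: projT2 (cid (atlas_cover S p)). Qed.

Definition pinched_in i f p :=
  pinched (metric i (cmap (atlas i) p))
    (hessian i (f \o cinv (atlas i)) (cmap (atlas i) p)).

Definition sqgrad_in i f p :=
  let x := cmap (atlas i) p in let v := gradient i (f \o cinv (atlas i)) x in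
  form_eval (metric i x) v v.

Lemma overlap_cmap i j p : cdom (atlas i) p -> cdom (atlas j) p ->
  overlap (atlas i) (atlas j) (cmap (atlas i) p).
Proof. by move=> ip jp; exists p. Qed.

Lemma transition_cmap i j p : cdom (atlas i) p ->
  (transition (atlas i) (atlas j) 0 (cmap (atlas i) p),
   transition (atlas i) (atlas j) 1 (cmap (atlas i) p)) = cmap (atlas j) p.
Proof. by move=> ip; rewrite transitionE cmapK. Qed.

(** The bounds of [pinched] are between quadratic forms, and both forms change by
    the same congruence. *)
Lemma pinched_in_change i j f p : smooth S f ->
  cdom (atlas i) p -> cdom (atlas j) p -> pinched_in j f p -> pinched_in i f p.
Proof.
move=> sf ip jp fp v; have Ox := overlap_cmap ip jp.
have Hv : form_eval (hessian i (f \o cinv (atlas i)) (cmap (atlas i) p)) v v =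
   form_eval (hessian j (f \o cinv (atlas j)) (cmap (atlas j) p))
     (Defs.jacobian (atlas i) (atlas j) (cmap (atlas i) p) *m v)
     (Defs.jacobian (atlas i) (atlas j) (cmap (atlas i) p) *m v).
  by rewrite (hessian_change (sf j 2%N) Ox) transition_cmap// /form_eval trmx_mul !mulmxA.
by rewrite (metric_form_change _ _ Ox) transition_cmap// Hv; exact: fp.
Qed.

Lemma sqgrad_in_change i j f p : smooth S f ->
  cdom (atlas i) p -> cdom (atlas j) p -> sqgrad_in i f p = sqgrad_in j f p.
Proof.
move=> sf ip jp; have Ox := overlap_cmap ip jp.
by rewrite /sqgrad_in (metric_form_change _ _ Ox) (gradient_change (sf j 1%N) Ox)
  transition_cmap.
Qed.

Lemma sqgradE f p : sqgrad S f p = sqgrad_in (chart_at S p) f p.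
Proof. by []. Qed.

Lemma near_cinv i p (A : set M) : cdom (atlas i) p -> nbhs p A ->
  \forall x \near cmap (atlas i) p, A (cinv (atlas i) x).
Proof.
move=> ip Ap; apply: (cinv_continuous_at (cimg_cmap ip)).
by rewrite /= cmapK.
Qed.

Lemma near_pderiv2 (F G : R * R -> R) (a b : 'I_2) (x : R * R) : (\near x, F x = G x) ->
  pderiv a (pderiv b F) x = pderiv a (pderiv b G) x.
Proof.
move=> FG; apply: near_pderiv; have := nbhs_interior FG.
by apply: filterS => y yFG; exact: near_pderiv.
Qed.

Lemma near_gradient i (F G : R * R -> R) x : (\near x, F x = G x) ->
  gradient i F x = gradient i G x.
Proof.
move=> FG; congr (_ *m _); apply/matrixP => a b; rewrite !mxE; exact: near_pderiv.
Qed.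

Lemma near_hessian i (F G : R * R -> R) x : (\near x, F x = G x) ->
  hessian i F x = hessian i G x.
Proof.
move=> FG; apply/matrixP => a b; rewrite !mxE (near_pderiv2 _ _ FG).
by congr (_ - _); apply: eq_bigr => c _; rewrite (near_pderiv c FG).
Qed.

Lemma near_pinched_in i f f' p : cdom (atlas i) p -> (\near p, f p = f' p) ->
  pinched_in i f p -> pinched_in i f' p.
Proof. by move=> ip /(near_cinv ip) ff'; rewrite /pinched_in (near_hessian i ff'). Qed.

Lemma near_sqgrad_in i f f' p : cdom (atlas i) p -> (\near p, f p = f' p) ->
  sqgrad_in i f p = sqgrad_in i f' p.
Proof. by move=> ip /(near_cinv ip) ff'; rewrite /sqgrad_in (near_gradient i ff'). Qed.

Lemma carleman_pointwise f u p (s : R) : pinched_in (chart_at S p) f p ->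
  1 / 4 * (sqgrad S u p + s ^+ 2) <= hess_grad S f u p
    + (1 / 2 - laplace_beltrami S f p / 2) * sqgrad S u p
    + (laplace_beltrami S f p / 2 - 1 / 2) * s ^+ 2.
Proof.
move=> fp; apply: pinched_carleman fp; apply: metric_posdef.
exact/cimg_cmap/cdom_chart_at.
Qed.

Lemma sqgrad_ge0 u p : 0 <= sqgrad S u p.
Proof. by apply/posdef_ge0/metric_posdef/cimg_cmap/cdom_chart_at. Qed.

End pointwise.

(** * A quadratic polynomial with pinched Hessian near a point *)

Section quadratic.
Context {R : realType}.
Implicit Types (g G H : 'M[R]_2) (x : R * R) (v : 'cV[R]_2).

Definition quadratic G (x0 : R * R) x : R :=
  2^-1 * (G 0 0 * ((x.1 - x0.1) * (x.1 - x0.1)) + 2 * G 0 1 * ((x.1 - x0.1) * (x.2 - x0.2))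
   + G 1 1 * ((x.2 - x0.2) * (x.2 - x0.2))).

Lemma is_derive_affine1 (c : R) x a : is_derive x (ebasis R a) (fun y => y.1 - c) (ebasis R a).1.
Proof.
apply: (@is_derive_coord1 R (fun t => t - c)).
have := is_deriveB (is_derive_id x.1 (ebasis R a).1) (is_derive_cst c x.1 (ebasis R a).1).
by rewrite subr0.
Qed.

Lemma is_derive_affine2 (c : R) x a : is_derive x (ebasis R a) (fun y => y.2 - c) (ebasis R a).2.
Proof.
apply: (@is_derive_coord2 R (fun t => t - c)).
have := is_deriveB (is_derive_id x.2 (ebasis R a).2) (is_derive_cst c x.2 (ebasis R a).2).
by rewrite subr0.
Qed.

Lemma pderiv_quadratic G (x0 : R * R) a x : G 1 0 = G 0 1 ->
  pderiv a (quadratic G x0) x = G a 0 * (x.1 - x0.1) + G a 1 * (x.2 - x0.2).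
Proof.
move=> Gs.
have d1 := is_derive_affine1 x0.1 x a; have d2 := is_derive_affine2 x0.2 x a.
have dM F F' (d d' : R) : is_derive x (ebasis R a) F d -> is_derive x (ebasis R a) F' d' ->
  is_derive x (ebasis R a) (fun y => F y * F' y) (F x * d' + F' x * d).
  by move=> dF dF'; exact: (is_deriveM dF dF').
have dD F F' (d d' : R) : is_derive x (ebasis R a) F d -> is_derive x (ebasis R a) F' d' ->
  is_derive x (ebasis R a) (fun y => F y + F' y) (d + d').
  by move=> dF dF'; exact: (is_deriveD dF dF').
have dZ F (k d : R) : is_derive x (ebasis R a) F d ->
  is_derive x (ebasis R a) (fun y => k * F y) (k * d).
  by move=> dF; exact: (is_deriveZ k dF).
have := dZ _ 2^-1 _ (dD _ _ _ _ (dD _ _ _ _ (dZ _ (G 0 0) _ (dM _ _ _ _ d1 d1))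
  (dZ _ (2 * G 0 1) _ (dM _ _ _ _ d1 d2))) (dZ _ (G 1 1) _ (dM _ _ _ _ d2 d2))).
move=> dQ; rewrite /pderiv; have /= -> := @derive_val _ _ _ _ _ _ _ dQ.
by clear -Gs; move: a; apply: ord2_ind; rewrite /ebasis/= ?Gs; field.
Qed.

Lemma pderiv2_quadratic G (x0 : R * R) a b x : G 1 0 = G 0 1 ->
  pderiv a (pderiv b (quadratic G x0)) x = G b a.
Proof.
move=> Gs.
have -> : pderiv b (quadratic G x0) =
    fun y => G b 0 * (y.1 - x0.1) + G b 1 * (y.2 - x0.2).
  by apply/funext => y; exact: pderiv_quadratic.
have d1 := is_derive_affine1 x0.1 x a; have d2 := is_derive_affine2 x0.2 x a.
have := is_deriveD (is_deriveZ (G b 0) d1) (is_deriveZ (G b 1) d2).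
move=> dQ; rewrite /pderiv; have /= -> := @derive_val _ _ _ _ _ _ _ dQ.
rewrite /GRing.scale/=.
by move: a {d1 d2 dQ}; apply: ord2_ind; rewrite /ebasis/=; ring.
Qed.

Lemma Ck_quadratic k D G x0 : open D -> Ck k D (quadratic G (x0 : R * R)).
Proof.
move=> oD.
have C1 : Ck k D (fun y => y.1 - x0.1) by apply: CkD => //; [exact: Ck_coord1|exact: Ck_cst].
have C2 : Ck k D (fun y => y.2 - x0.2) by apply: CkD => //; [exact: Ck_coord2|exact: Ck_cst].
by do ! [exact: C1|exact: C2|exact: Ck_cst|apply: CkD => //|apply: CkM => //].
Qed.

(** A perturbation whose entries are at most e changes the quadratic form by at
    most 2 e |v|^2, and [posdef_coercive] compares |v|^2 with the form of g. *)
Lemma pinched_of_close g H (e : R) : posdef g ->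
  (forall a b, `|H a b - g a b| <= e) -> 20 * e <= \det g / \tr g -> pinched g H.
Proof.
move=> pg Hg e20 v; have := posdef_coercive v pg.
have e0 : 0 <= e := le_trans (normr_ge0 _) (Hg 0 0).
set q := v 0 0 ^+ 2 + v 1 0 ^+ 2.
have q0 : 0 <= q by rewrite addr_ge0 ?sqr_ge0.
move=> /(le_trans (ler_wpM2r q0 e20)) gq.
suff : `|form_eval H v v - form_eval g v v| <= 2 * e * q.
  rewrite ler_norml; move: gq.
  have -> : 20 * e * q = 10 * (2 * e * q) by ring.
  move: (2 * e * q) (form_eval H v v) (form_eval g v v) => a b c.
  clear; lra.
have -> : form_eval H v v - form_eval g v v =
  (H 0 0 - g 0 0) * (v 0 0 * v 0 0) + (H 0 1 - g 0 1) * (v 0 0 * v 1 0)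
  + (H 1 0 - g 1 0) * (v 0 0 * v 1 0) + (H 1 1 - g 1 1) * (v 1 0 * v 1 0).
  by rewrite !form2; ring.
have B a b (y z : R) : `|(H a b - g a b) * (y * z)| <= e * ((y ^+ 2 + z ^+ 2) / 2).
  rewrite normrM ler_pM// ler_norml.
  have := sqr_ge0 (y - z); have := sqr_ge0 (y + z); rewrite !expr2.
  by clear; move=> *; lra.
rewrite (le_trans (ler_normD _ _))//.
have := lerD (lerD (B 0 0 (v 0 0) (v 0 0)) (B 0 1 (v 0 0) (v 1 0)))
             (lerD (B 1 0 (v 0 0) (v 1 0)) (B 1 1 (v 1 0) (v 1 0))).
have n3 := ler_normD ((H 0 0 - g 0 0) * (v 0 0 * v 0 0) + (H 0 1 - g 0 1) * (v 0 0 * v 1 0))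
   ((H 1 0 - g 1 0) * (v 0 0 * v 1 0)).
have n2 := ler_normD ((H 0 0 - g 0 0) * (v 0 0 * v 0 0)) ((H 0 1 - g 0 1) * (v 0 0 * v 1 0)).
move: n3 n2.
rewrite (_ : e * _ + _ + (_ + _) = 2 * e * q); last by rewrite /q; field.
by clear; move=> *; lra.
Qed.

(** [posdef_coercive] for the adjugate of g, which has the same trace and the same
    determinant as g. *)
Lemma inverse_form_ge g (w : 'cV[R]_2) : posdef g ->
  (w 0 0 ^+ 2 + w 1 0 ^+ 2) / \tr g <=
    form_eval g (invmx g *m w) (invmx g *m w).
Proof.
move=> pg; have ug := posdef_unit pg; have gs := posdef_sym pg.
have dg := posdef_det pg; have g0 := posdef00 pg; have g1 := posdef11 pg.
have -> : form_eval g (invmx g *m w) (invmx g *m w) =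
   (\det g)^-1 * (g 1 1 * w 0 0 ^+ 2 - 2 * g 0 1 * (w 0 0 * w 1 0) + g 0 0 * w 1 0 ^+ 2).
  rewrite /form_eval trmx_mul -!mulmxA (mulKVmx ug) trmx_inv.
  have gT : g^T = g by case: pg.
  rewrite gT mxE sum2 !mxE !sum2 !invmx2//= !subr0 !subrr gs.
  by move: (\det g) => d; ring.
rewrite mxtrace2 ler_pdivrMr ?addr_gt0// -(ler_pM2l dg).
rewrite [leRHS]mulrA mulVKf ?gt_eqF// det2 gs.
have := sqr_ge0 (g 1 1 * w 0 0 - g 0 1 * w 1 0).
have := sqr_ge0 (g 0 0 * w 1 0 - g 0 1 * w 0 0).
rewrite !expr2; move: (g 0 0) (g 0 1) (g 1 1) (w 0 0) (w 1 0) => a b c x y.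
clear; lra.
Qed.

(** Cramer and Cauchy-Schwarz: det G z_0 = G_11 w_0 - G_01 w_1 for w = G z. *)
Lemma linear_image_ge G (z : 'cV[R]_2) : posdef G ->
  (\det G * z 0 0) ^+ 2 / (G 1 1 ^+ 2 + G 0 1 ^+ 2)
    <= (G *m z) 0 0 ^+ 2 + (G *m z) 1 0 ^+ 2.
Proof.
move=> pG; have G1 := posdef11 pG.
rewrite ler_pdivrMr; last by rewrite ltr_wpDr ?sqr_ge0// exprn_gt0.
rewrite det2 !mxE !sum2 (posdef_sym pG).
have := sqr_ge0 (G 1 1 * (G 0 1 * z 0 0 + G 1 1 * z 1 0) + G 0 1 * (G 0 0 * z 0 0 + G 0 1 * z 1 0)).
rewrite !expr2; move: (G 0 0) (G 0 1) (G 1 1) (z 0 0) (z 1 0) => a b c x y.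
clear; lra.
Qed.

End quadratic.

Section near_point.
Context {R : realType} {M : topologicalType} (S : riemannian_surface R M).
Variables (i : atlas_index S) (y : R * R).
Hypothesis iy : cimg (atlas i) y.
Implicit Types (a b c : 'I_2).

Let g := metric i y.

Lemma continuous_metric a b : {for y, continuous (fun x => metric i x a b)}.
Proof. exact: Ck_continuous (metric_C2 i a b) iy. Qed.

Lemma continuous_det_metric : {for y, continuous (fun x => \det (metric i x))}.
Proof.
rewrite (_ : (fun x => _) = fun x =>
  metric i x 0 0 * metric i x 1 1 - metric i x 0 1 * metric i x 1 0).
  by apply: (@cvgB _ R^o); apply: (@cvgM R); exact: continuous_metric.
by apply/funext => x; exact: det2.
Qed.

Lemma continuous_tr_metric : {for y, continuous (fun x => \tr (metric i x))}.
Proof.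
rewrite (_ : (fun x => _) = fun x => metric i x 0 0 + metric i x 1 1).
  by apply: (@cvgD _ R^o); exact: continuous_metric.
by apply/funext => x; exact: mxtrace2.
Qed.

Lemma continuous_invmx_metric a b : {for y, continuous (fun x => invmx (metric i x) a b)}.
Proof.
have N : \forall x \near y, (\det (metric i x))^-1 *
   (if a == b then metric i x (1 - a) (1 - b) else - metric i x a b) = invmx (metric i x) a b.
  apply: filterS (near_cimg iy) => x ix; rewrite invmx2//.
  exact/posdef_unit/metric_posdef.
rewrite /prop_for /continuous_at -(nbhs_singleton N).
apply: cvg_trans (near_eq_cvg N) _; apply: (@cvgM R).
  apply: cvgV; last exact: continuous_det_metric.
  by rewrite gt_eqF// posdef_det//; exact: metric_posdef.
by case: ifP => _; [|apply: (@cvgN _ R^o)]; exact: continuous_metric.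
Qed.

Lemma continuous_christoffel c a b : {for y, continuous (christoffel i c a b)}.
Proof.
have dg d a' b' : {for y, continuous (pderiv d (fun x => metric i x a' b'))}.
  exact: Ck_continuous (Ck_pderiv d (metric_C2 i a' b')) iy.
rewrite (_ : christoffel i c a b = fun x => 2^-1 *
  (invmx (metric i x) c 0 * (pderiv a (fun y => metric i y b 0) x
     + pderiv b (fun y => metric i y a 0) x - pderiv 0 (fun y => metric i y a b) x)
  + invmx (metric i x) c 1 * (pderiv a (fun y => metric i y b 1) x
     + pderiv b (fun y => metric i y a 1) x - pderiv 1 (fun y => metric i y a b) x))); last first.
  by apply/funext => x; rewrite /christoffel sum2.
have cD (F G : R * R -> R) : {for y, continuous F} -> {for y, continuous G} ->
    {for y, continuous (fun x => F x + G x)}.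
  by move=> cF cG; exact: (@cvgD _ R^o).
have cB (F G : R * R -> R) : {for y, continuous F} -> {for y, continuous G} ->
    {for y, continuous (fun x => F x - G x)}.
  by move=> cF cG; exact: (@cvgB _ R^o).
have cM (F G : R * R -> R) : {for y, continuous F} -> {for y, continuous G} ->
    {for y, continuous (fun x => F x * G x)}.
  by move=> cF cG; exact: (@cvgM R).
have cI := continuous_invmx_metric.
apply: (cM _ _ _ _); first exact: cvg_cst.
by apply: (cD _ _ _ _); apply: (cM _ _ _ _) => //; apply: (cB _ _ _ _) => //; apply: (cD _ _ _ _).
Qed.

(** The base point z.1 and the critical point z.2 move independently; the gradient
    at z.1 tends to zero when both tend to y, and with it the Christoffel terms. *)
Lemma hessian_quadratic_cvg a b :
  hessian i (quadratic g z.2) z.1 a b - metric i z.1 a b @[z --> (y, y)] --> (0 : R).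
Proof.
have gs : g 1 0 = g 0 1 := posdef_sym (metric_posdef iy).
have gab : g b a = g a b.
  by rewrite /g -[in LHS](Defs.metric_sym iy) mxE.
have fstC (F : R * R -> R) : {for y, continuous F} -> F z.1 @[z --> (y, y)] --> F y.
  have cf : {for (y, y), continuous (fst : (R * R) * (R * R) -> R * R)} by exact: cvg_fst.
  by move=> cF; exact: (continuous_comp cf cF).
have dC (p : R * R -> R) : continuous p -> p z.1 - p z.2 @[z --> (y, y)] --> (0 : R).
  move=> cp; rewrite -(subrr (p y)); apply: (@cvgB _ R^o).
    exact: (fstC _ (cp y)).
  have cs : {for (y, y), continuous (snd : (R * R) * (R * R) -> R * R)} by exact: cvg_snd.
  exact: (continuous_comp cs (cp y)).
have c1 : continuous (fst : R * R -> R) by move=> x; exact: cvg_fst.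
have c2 : continuous (snd : R * R -> R) by move=> x; exact: cvg_snd.
pose u c (z : (R * R) * (R * R)) := g c 0 * (z.1.1 - z.2.1) + g c 1 * (z.1.2 - z.2.2).
have uC c : u c z @[z --> (y, y)] --> (0 : R).
  rewrite [X in _ --> X](_ : 0 = g c 0 * 0 + g c 1 * 0); last by rewrite !mulr0 addr0.
  apply: (@cvgD _ R^o); apply: (@cvgM R); try exact: cvg_cst.
    exact: (dC _ c1).
  exact: (dC _ c2).
rewrite (_ : (fun z => _) = fun z => g b a - (christoffel i 0 a b z.1 * u 0 z
    + christoffel i 1 a b z.1 * u 1 z) - metric i z.1 a b); last first.
  apply/funext => z; rewrite mxE pderiv2_quadratic// sum2 !pderiv_quadratic//.
rewrite [X in _ --> X](_ : 0 = g b a - (christoffel i 0 a b y * 0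
    + christoffel i 1 a b y * 0) - g a b); last by rewrite gab; ring.
apply: (@cvgB _ R^o); last exact: (fstC _ (@continuous_metric a b)).
apply: (@cvgB _ R^o); first exact: cvg_cst.
by apply: (@cvgD _ R^o); apply: (@cvgM R); [exact: (fstC _ (@continuous_christoffel 0 a b))|
  exact: uC|exact: (fstC _ (@continuous_christoffel 1 a b))|exact: uC].
Qed.

(** The bound on the determinant serves to show that the patch has finite volume. *)
Lemma pinched_quadratic_near : exists (r : R) (x0 : R * R) (e L : R), [/\ 0 < r, 0 < e &
  forall x, `|x - y| < r ->
    [/\ cimg (atlas i) x,
        pinched (metric i x) (hessian i (quadratic g x0) x),
        e <= form_eval (metric i x) (gradient i (quadratic g x0) x)
                                   (gradient i (quadratic g x0) x)
      & \det (metric i x) <= L ]].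
Proof.
have pg : posdef g := metric_posdef iy.
have dg := posdef_det pg; have gs := posdef_sym pg.
have g0 := posdef00 pg; have g1 := posdef11 pg.
have tg : 0 < \tr g by rewrite mxtrace2 addr_gt0.
(* pinched_of_close requires 1/20 of det / tr at the point x; half of its value
   at y leaves room for x to move. *)
pose m := \det g / \tr g / 40.
have m0 : 0 < m by rewrite !divr_gt0.
have cm : {for y, continuous (fun x => \det (metric i x) / \tr (metric i x) / 20)}.
  apply: (@cvgM R); last exact: cvg_cst.
  apply: (@cvgM R); first exact: continuous_det_metric.
  by apply: cvgV; [rewrite gt_eqF|exact: continuous_tr_metric].
have N1 : \forall x \near y, m < \det (metric i x) / \tr (metric i x) / 20.
  have : m < \det g / \tr g / 20 by rewrite ltr_pM2l ?divr_gt0// ltf_pV2 ?posrE// ltr_nat.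
  exact: (cvgr_gt _ cm).
have N2 : \forall x \near y, \det (metric i x) < \det g + 1.
  by apply: (cvgr_lt _ continuous_det_metric); rewrite ltrDl.
have N3 : \forall x \near y, \tr (metric i x) < \tr g + 1.
  by apply: (cvgr_lt _ continuous_tr_metric); rewrite ltrDl.
have NH a b : \forall z \near (y, y),
    `|hessian i (quadratic g z.2) z.1 a b - metric i z.1 a b| < m.
  have /cvgrPdist_lt/(_ m m0) := @hessian_quadratic_cvg a b.
  by apply: filterS => z; rewrite sub0r normrN.
have : \forall z \near (y, y), forall a b,
    `|hessian i (quadratic g z.2) z.1 a b - metric i z.1 a b| < m.
  near=> z; apply: ord2_ind; apply: ord2_ind; near: z; exact: NH.
move=> [[A B] /= [Ay By] AB].
have /nbhs_ballP[d /= d0 dA] : nbhs y (A `&` (cimg (atlas i) `&` [set x |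
  [/\ m < \det (metric i x) / \tr (metric i x) / 20,
      \det (metric i x) < \det g + 1 & \tr (metric i x) < \tr g + 1]])).
  apply: filterI => //; apply: filterI; first exact: near_cimg.
  by apply: filterS3 N1 N2 N3 => x; split.
have /nbhs_ballP[d' /= d'0 dB] := By.
pose s := Num.min d d'; have s0 : 0 < s by rewrite lt_min d0.
pose x0 : R * R := (y.1 + s / 2, y.2).
have s4 : 0 < s / 4 by rewrite divr_gt0.
have Bx0 : B x0.
  apply: dB; rewrite -ball_normE /ball_/= prod_normE /x0/= gt_max subrr normr0 d'0 andbT.
  rewrite opprD addrA subrr sub0r normrN gtr0_norm ?divr_gt0//.
  have : s <= d' by rewrite ge_min lexx orbT.
  by clear -s0; move=> ?; lra.
(* x0 is at distance s / 2 from y in the first coordinate, so the ball of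
   radius s / 4 around y stays at distance s / 4 from x0.  The lower bound for
   the gradient combines inverse_form_ge and linear_image_ge. *)
exists (s / 4), x0,
  ((\det g * (s / 4)) ^+ 2 / (g 1 1 ^+ 2 + g 0 1 ^+ 2) / (\tr g + 1)), (\det g + 1).
split=> //.
  rewrite divr_gt0 ?addr_gt0// divr_gt0 ?exprn_gt0 ?mulr_gt0//.
  by rewrite ltr_wpDr ?sqr_ge0// exprn_gt0.
move=> x xy.
have [Ax [ix [mx detx trx]]] : (A `&` (cimg (atlas i) `&` [set x |
  [/\ m < \det (metric i x) / \tr (metric i x) / 20,
      \det (metric i x) < \det g + 1 & \tr (metric i x) < \tr g + 1]])) x.
  apply: dA; rewrite -ball_normE /ball_/= distrC (lt_le_trans xy)//.
  have : s <= d by rewrite ge_min lexx.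
  by clear -s0; move=> ?; lra.
have px := metric_posdef ix.
split=> //; last exact: ltW.
- apply: (@pinched_of_close _ _ _ m) => //.
    by move=> a b; have := AB (x, x0) (conj Ax Bx0) a b => /= /ltW.
  by rewrite mulrC -ler_pdivlMr// ltW.
- apply: le_trans (inverse_form_ge _ px).
  pose z : 'cV[R]_2 := \col_a (if a == 0 then x.1 - x0.1 else x.2 - x0.2).
  have -> : differential (quadratic g x0) x = g *m z.
    by apply: cveq2; rewrite !mxE pderiv_quadratic// sum2 !mxE.
  have trx0 : 0 < \tr (metric i x) by rewrite mxtrace2 addr_gt0 ?posdef00 ?posdef11.
  apply: ler_pM.
  - by rewrite divr_ge0 ?addr_ge0 ?sqr_ge0.
  - by rewrite invr_ge0 addr_ge0// ltW.
  - apply: le_trans (linear_image_ge z pg).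
    have lz : s / 4 < `|z 0 0|.
      rewrite mxE/= /x0/=.
      have : `|x.1 - y.1| < s / 4 by move: xy; rewrite prod_normE gt_max => /andP[].
      rewrite ltr_norml => /andP[_ h]; rewrite ltr_normr; apply/orP; right.
      by clear -s0 h; lra.
    rewrite ler_wpM2r ?invr_ge0 ?addr_ge0 ?sqr_ge0//.
    rewrite ![(\det g * _) ^+ 2]exprMn ler_wpM2l ?sqr_ge0//.
    by rewrite -[leRHS]real_normK ?num_real// lerXn2r ?nnegrE ?normr_ge0 ?(ltW s4) ?(ltW lz).
  - by rewrite lef_pV2 ?posrE ?addr_gt0// ltW.
Unshelve. all: by end_near. Qed.

End near_point.

(** * Integration of pointwise inequalities *)

Section integral_without_measurability.
Local Open Scope ereal_scope.
Context {d} {T : measurableType d} {R : realType} (mu : {measure set T -> \bar R}).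
Implicit Types (f g : T -> \bar R) (D : set T).
Import HBNNSimple.

(** The integrands of the theorem are computed in arbitrarily chosen charts and may
    fail to be measurable.  The integral of a nonnegative function is still a
    supremum over the simple functions below it, and the map h |-> c h sends the
    simple functions below f to simple functions below g. *)
Lemma scaled_integral_le (c : R) D D' f g : (0 < c)%R ->
  (forall x, D x -> 0 <= f x) -> (forall x, D' x -> 0 <= g x) ->
  D `<=` D' -> (forall x, D x -> c%:E * f x <= g x) ->
  c%:E * \int[mu]_(x in D) f x <= \int[mu]_(x in D') g x.
Proof.
move=> c0 f0 g0 DD' fg; rewrite !ge0_integralE//.
rewrite -lee_pdivlMl//; apply: ge_ereal_sup => _ [h /= hf <-].
rewrite lee_pdivlMl// -sintegralrM; apply: ereal_sup_ubound.
exists (scale_nnsfun h (ltW c0)) => //= x; rewrite EFinM.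
apply: le_trans (lee_wpmul2l _ (hf x)) _; first by rewrite lee_fin ltW.
rewrite !patchE; case: ifPn => [/[!inE] Dx|_].
  by rewrite mem_set ?fg//; exact: DD'.
by rewrite mule0; case: ifPn => // /[!inE] /g0.
Qed.

Lemma ge0_le_integral_subset D D' f g :
  (forall x, D x -> 0 <= f x) -> (forall x, D' x -> 0 <= g x) ->
  D `<=` D' -> (forall x, D x -> f x <= g x) ->
  \int[mu]_(x in D) f x <= \int[mu]_(x in D') g x.
Proof.
move=> f0 g0 DD' fg; rewrite -[leLHS]mul1e; apply: scaled_integral_le => // x Dx.
by rewrite mul1e fg.
Qed.

End integral_without_measurability.

Lemma iterated_integral_le (d d' : measure_display) (T : measurableType d)
    (T' : measurableType d') (R : realType) (mu : {measure set T -> \bar R})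
    (nu : {measure set T' -> \bar R}) (c : R) (A : set T) (B : set T')
    (f g : T -> T' -> R) : 0 < c ->
  (forall t x, A t -> B x -> 0 <= f t x) ->
  (forall t x, A t -> B x -> c * f t x <= g t x) ->
  (c%:E * \int[mu]_(t in A) \int[nu]_(x in B) (f t x)%:E
     <= \int[mu]_(t in A) \int[nu]_(x in B) (g t x)%:E)%E.
Proof.
move=> c0 f0 fg.
have g0 t x : A t -> B x -> 0 <= g t x.
  by move=> At Bx; apply: le_trans (fg t x At Bx); rewrite mulr_ge0 ?f0// ltW.
apply: scaled_integral_le => // [t At|t At|t At].
- by apply: integral_ge0 => x Bx; rewrite lee_fin f0.
- by apply: integral_ge0 => x Bx; rewrite lee_fin g0.
apply: scaled_integral_le => // [x Bx|x Bx|x Bx].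
- by rewrite lee_fin f0.
- by rewrite lee_fin g0.
by rewrite -EFinM lee_fin fg.
Qed.

(** * Exhaustion by boxes and volume *)

Section boxes.
Context {R : realType}.
Implicit Types (O : set (R * R)) (b : (R * R) * R) (s : seq ((R * R) * R)) (x : R * R).

Definition box_in O b := 0 < b.2 /\ forall x, `|x - b.1| <= 2 * b.2 -> O x.

(** The boxes of rational centre and radius are enumerated, and those whose double
    lies in O are kept; every point of O is in one of them because a small enough
    ball around it lies in O. *)
Lemma box_exhaustion O : open O -> exists s : nat -> seq ((R * R) * R),
  [/\ forall n b, b \in s n -> box_in O b,
      forall n m, (n <= m)%N -> {subset s n <= s m} &
      forall x, O x -> exists n, exists2 b, b \in s n & `|x - b.1| < b.2].
Proof.
move=> oO.
pose box (q : rat * rat * rat) : (R * R) * R := ((ratr q.1.1, ratr q.1.2), ratr q.2).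
pose pick_box k := obind (fun q => if `[< box_in O (box q) >] then Some (box q) else None)
   (unpickle k : option (rat * rat * rat)).
exists (fun n => pmap pick_box (iota 0 n)); split.
- move=> n b; rewrite mem_pmap => /mapP[k _]; rewrite /pick_box.
  case: unpickle => [q|]//=; case: ifPn => //.
  by move=> /asboolP Oq [->].
- move=> n m nm b; rewrite !mem_pmap => /mapP[k]; rewrite mem_iota add0n => /andP[_ kn] ->.
  by apply: map_f; rewrite mem_iota add0n (leq_trans kn).
move=> x Ox; have /nbhs_ballP[r /= r0 rO] := open_nbhs_nbhs (conj oO Ox).
have [c /[!in_itv]/= /andP[c0 cr]] : exists q : rat, ratr q \in `]0, (r / 3 : R)[.
  by apply: rat_in_itvoo; rewrite divr_gt0.
have approx (t : R) : exists q : rat, `|t - ratr q| < ratr c.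
  have [|q /[!in_itv]/= /andP[q1 q2]] := @rat_in_itvoo R (t - ratr c) (t + ratr c).
    by move: c0; clear; lra.
  by exists q; rewrite ltr_norml; move: q1 q2; clear; lra.
have [q1 xq1] := approx x.1; have [q2 xq2] := approx x.2.
have xq : `|x - (ratr q1, ratr q2)| < ratr c by rewrite prod_normE gt_max xq1 xq2.
have Oq : box_in O (box (q1, q2, c)).
  split=> //= y yq; apply: rO; rewrite -ball_normE /ball_/=.
  have -> : x - y = (x - (ratr q1, ratr q2)) - (y - (ratr q1, ratr q2)).
    by rewrite opprB addrA subrK.
  rewrite (le_lt_trans (ler_normB _ _))// (lt_le_trans (ltr_leD xq yq))//.
  by move: cr; clear; lra.
exists (pickle (q1, q2, c)).+1, (box (q1, q2, c)) => //.
rewrite mem_pmap; apply/mapP; exists (pickle (q1, q2, c)).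
  by rewrite mem_iota add0n leqnn.
by rewrite /pick_box pickleK/= asboolT.
Qed.

(** Equal to 1 as soon as one factor of the product vanishes, and to 0 when all
    bumps vanish: a smooth substitute for the union of the boxes. *)
Definition cutoff s x : R := 1 - \prod_(b <- s) (1 - box_bump b.1 b.2 x).

Lemma Ck_cutoff k s : Ck k setT (cutoff s).
Proof.
have oT : open [set: R * R] by exact: openT.
have CB F : Ck k setT F -> Ck k setT (fun x : R * R => 1 - F x).
  move=> CF; apply: (@eq_Ck _ k setT (fun x => 1 + (-1) * F x)) => //.
    by move=> x _; rewrite mulN1r.
  by apply: CkD => //; [exact: Ck_cst|apply: CkM => //; exact: Ck_cst].
apply: (CB _ _); elim: s => [|b s IH].
  rewrite (_ : (fun x => _) = fun=> 1); first exact: Ck_cst.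
  by apply/funext => x; rewrite big_nil.
rewrite (_ : (fun x => _) = fun x =>
  (1 - box_bump b.1 b.2 x) * \prod_(b <- s) (1 - box_bump b.1 b.2 x)).
  by apply: CkM => //; apply: (CB _ _); exact: Ck_box_bump.
by apply/funext => x; rewrite big_cons.
Qed.

Lemma cutoff1 s b x : b \in s -> `|x - b.1| <= b.2 -> cutoff s x = 1.
Proof.
move=> bs xb; rewrite /cutoff (big_rem b)//= box_bump1// subrr mul0r subr0//.
Qed.

Lemma cutoff0 s x : (forall b, b \in s -> 0 < b.2 /\ 2 * b.2 <= `|x - b.1|) ->
  cutoff s x = 0.
Proof.
move=> H; rewrite /cutoff big_seq big1 ?subrr// => b /H[b0 xb].
by rewrite box_bump0 ?subr0.
Qed.

Lemma compact_box (c : R * R) (r : R) : compact [set x : R * R | `|x - c| <= r].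
Proof.
have -> : [set x : R * R | `|x - c| <= r] =
    `[c.1 - r, c.1 + r] `*` `[c.2 - r, c.2 + r].
  by apply/seteqP; split=> x /=; rewrite prod_normE ge_max /= !in_itv/= !ler_distl => /andP.
by apply: compact_setX; exact: segment_compact.
Qed.

End boxes.

Section volume.
Context {R : realType} {M : ptopologicalType} (S : riemannian_surface R M).
Variables (vol : {measure set (borel M) -> \bar R}).
Hypothesis vol_riemannian : riemannian_measure S vol.

Lemma open_measurable_borel (A : set M) : open A -> measurable (A : set (borel M)).
Proof. by move=> oA; exact: sub_sigma_algebra. Qed.

(** The volume is the integral of the square root of the determinant, which is
    bounded, over a subset of a box. *)
Lemma finite_volume (i : atlas_index S) (y : R * R) (r L : R) (A : set M) :
  open A -> A `<=` cdom (atlas i) ->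
  (forall p, A p -> `|cmap (atlas i) p - y| <= r /\ \det (metric i (cmap (atlas i) p)) <= L) ->
  (vol A < +oo)%E.
Proof.
move=> oA Ai AL; rewrite (vol_riemannian (open_measurable_borel oA) Ai).
pose I1 : set R := `[y.1 - r, y.1 + r]%classic.
pose I2 : set R := `[y.2 - r, y.2 + r]%classic.
pose Q : set (R * R) := I1 `*` I2.
have mQ : measurable Q by apply: measurableX; exact: measurable_itv.
apply: (@le_lt_trans _ _ (\int[(@lebesgue_measure R \x @lebesgue_measure R)%E]_(x in Q)
  (Num.sqrt L)%:E)%E).
  apply: ge0_le_integral_subset.
  - by move=> x _; rewrite lee_fin sqrtr_ge0.
  - by move=> x _; rewrite lee_fin sqrtr_ge0.
  - move=> _ [p Ap <-]; have [+ _] := AL p Ap.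
    by rewrite prod_normE ge_max/= /Q/I1/I2/= !in_itv/= !ler_distl => /andP.
  - by move=> _ [p Ap <-]; have [_ ?] := AL p Ap; rewrite lee_fin ler_wsqrtr.
rewrite integral_cst// lte_mul_pinfty ?lee_fin ?sqrtr_ge0//.
rewrite [X in (X < _)%E](_ : _ = (lebesgue_measure I1 * lebesgue_measure I2)%E); last first.
  by apply: product_measure1E; exact: measurable_itv.
rewrite !lebesgue_measure_itv/=; case: ifP => _; case: ifP => _;
  by rewrite ?mul0e ?mule0// -!EFinB -EFinM ltry.
Qed.

(** Continuity from above of the measure along W minus V n. *)
Lemma exhausted_volume (W : set M) (V : nat -> set M) (e : R) : 0 < e ->
  open W -> (vol W < +oo)%E -> (forall n, open (V n)) ->
  (forall n m, (n <= m)%N -> V n `<=` V m) -> W `<=` \bigcup_n V n ->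
  exists n, (vol (W `\` V n) <= e%:E)%E.
Proof.
move=> e0 oW Woo oV Vm WV.
pose F n : set (borel M) := W `\` V n.
have mF n : measurable (F n).
  by apply: measurableD; exact: open_measurable_borel.
have F0 : (\bigcap_n F n : set (borel M)) = set0.
  apply/seteqP; split=> // p Fp; have [Wp _] := Fp 0%N I.
  by have [n _ Vp] := WV p Wp; have [_] := Fp n I.
have mF0 : measurable (\bigcap_n F n : set (borel M)) by rewrite F0; exact: measurable0.
have cF : (vol \o F) n @[n --> \oo] --> vol (\bigcap_n F n).
  apply: nonincreasing_cvg_mu => //.
  - apply: le_lt_trans Woo; apply: le_measure; rewrite ?inE//;
      [exact: open_measurable_borel|exact: subDsetl].
  - by move=> n m nm; apply/subsetPset; apply: setDS; exact: Vm.
rewrite F0 measure0 in cF.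
have N : nbhs (0 : \bar R)%E [set x | (x < e%:E)%E].
  by apply: open_nbhs_nbhs; split; [exact: open_ereal_lt_ereal|rewrite /= lte_fin].
have [n _ Hn] := cF _ N.
by exists n; apply: ltW; exact: (Hn n (leqnn n)).
Qed.

End volume.

(** * Construction of the function *)

Section pieces.
Context {R : realType} {M : ptopologicalType} (S : riemannian_surface R M).
Variables (vol : {measure set (borel M) -> \bar R}).
Hypothesis vol_riemannian : riemannian_measure S vol.
Implicit Types (i : atlas_index S) (f : M -> R) (U V W K : set M).

(** [box_exhaustion] is applied to the image O of W in the chart: V is a finite
    union of boxes, K the union of the doubled closed boxes.  K is closed in the
    surface, not only in W, because the doubled boxes are compact and the surface
    is Hausdorff.  The function is the cutoff times F in the chart, and zero
    elsewhere. *)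
Lemma local_piece i W (F : R * R -> R) (e : R) : open W -> W `<=` cdom (atlas i) ->
  (vol W < +oo)%E -> Cinfty setT F -> 0 < e ->
  exists f V K, [/\ [/\ smooth S f, open V, closed K, V `<=` K & K `<=` W],
    forall p, ~ K p -> f p = 0,
    forall p, V p -> f p = F (cmap (atlas i) p) &
    (vol (W `\` V) <= e%:E)%E].
Proof.
move=> oW Wi Woo CF e0.
pose O := cmap (atlas i) @` W.
have OE x : O x -> cimg (atlas i) x /\ W (cinv (atlas i) x).
  by move=> [p Wp <-]; rewrite cmapK; [split=> //; exact/cimg_cmap/Wi|exact: Wi].
have oO : open O.
  rewrite openE => x /OE[ix Wx].
  have N : \forall x' \near x, W (cinv (atlas i) x').
    by apply: (cinv_continuous_at ix); exact: open_nbhs_nbhs.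
  apply: filterS2 N (near_cimg ix) => x' Wx' ix'.
  by exists (cinv (atlas i) x') => //; exact: cinvK.
have [s [sO sm scov]] := box_exhaustion oO.
pose V n : set M := [set p | cdom (atlas i) p /\
  exists2 b, b \in s n & `|cmap (atlas i) p - b.1| < b.2].
have oV n : open (V n).
  rewrite openE => p [ip [b bs pb]].
  have N : \forall q \near p, `|cmap (atlas i) q - b.1| < b.2.
    have B : nbhs (cmap (atlas i) p) [set x | `|x - b.1| < b.2].
      apply: open_nbhs_nbhs; split=> //.
      have -> : [set x | `|x - b.1| < b.2] = ball b.1 b.2.
        by apply/seteqP; split=> x; rewrite -ball_normE /ball_/= distrC.
      apply: ball_open; exact: le_lt_trans (normr_ge0 _) pb.
    exact: (cmap_continuous_at ip B).
  by apply: filterS2 N (near_cdom ip) => q qb iq; split=> //; exists b.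
have [||n Vn] := @exhausted_volume R M vol W V e e0 oW Woo oV.
- by move=> n m nm p [ip [b bs pb]]; split=> //; exists b => //; exact: sm bs.
- move=> p Wp; have [|n [b bs pb]] := scov (cmap (atlas i) p); first by exists p.
  by exists n => //; split; [exact: Wi|exists b].
pose K : set M := [set p | exists2 b, b \in s n &
  (cinv (atlas i) @` [set x | `|x - b.1| <= 2 * b.2]) p].
have KP p : K p -> cdom (atlas i) p /\ exists2 b, b \in s n & `|cmap (atlas i) p - b.1| <= 2 * b.2.
  move=> [b bs [x /= xb <-]]; have [ix _] := OE x ((sO _ _ bs).2 _ xb).
  by split; [exact: cdom_cinv|exists b; rewrite ?cinvK].
have PK p b : cdom (atlas i) p -> b \in s n -> `|cmap (atlas i) p - b.1| <= 2 * b.2 -> K p.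
  by move=> ip bs pb; exists b => //; exists (cmap (atlas i) p); [exact: pb|rewrite cmapK].
have KW : K `<=` W by move=> _ [b bs [x /= xb <-]]; exact: (OE x ((sO _ _ bs).2 _ xb)).2.
have clK : closed K.
  have sO' b : b \in s n -> box_in O b by exact: sO.
  rewrite /K; elim: (s n) sO' => [_|b l IH lO].
    by rewrite (_ : [set _ | _] = set0); [exact: closed0|apply/seteqP; split=> p // -[]].
  rewrite (_ : [set _ | _] = (cinv (atlas i) @` [set x | `|x - b.1| <= 2 * b.2]) `|`
     [set p | exists2 b, b \in l & (cinv (atlas i) @` [set x | `|x - b.1| <= 2 * b.2]) p]).
    apply: closedU; last by apply: IH => b' b'l; apply: lO; rewrite inE b'l orbT.
    apply: compact_closed; first exact: surface_hausdorff S.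
    apply: continuous_compact; last exact: compact_box.
    apply: continuous_in_subspaceT => x /[!inE]/= xb.
    have [] := OE x ((lO b _).2 _ xb); first by rewrite inE eqxx.
    by move=> ix _; exact: cinv_continuous_at.
  apply/seteqP; split=> p.
    by move=> [b' + pb]; rewrite inE => /orP[/eqP bb|bl]; [left; rewrite -bb|right; exists b'].
  by move=> [pb|[b' bl pb]]; [exists b; rewrite ?inE ?eqxx|exists b'; rewrite ?inE ?bl ?orbT].
pose G x := cutoff (s n) x * F x.
have CG k : Ck k (cimg (atlas i)) G.
  by apply: (@Ck_sub _ k setT) => //; apply: CkM; [exact: openT|exact: Ck_cutoff|exact: CF].
pose f p : R := if `[< cdom (atlas i) p >] then G (cmap (atlas i) p) else 0.
have fK p : ~ K p -> f p = 0.
  move=> nKp; rewrite /f; case: ifPn => // /asboolP ip.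
  rewrite /G cutoff0 ?mul0r// => b bs; split; first exact: (sO _ _ bs).1.
  by rewrite leNgt; apply/negP => /ltW pb; apply: nKp; exact: PK pb.
exists f, (V n), K; split=> //; [split=> //|].
- move=> l k; apply: Ck_local => x lx.
  have [ix|nix] := pselect (cdom (atlas i) (cinv (atlas l) x)).
    exists (overlap (atlas l) (atlas i)); first exact/overlapP.
    apply: eq_Ck (@Ck_change _ _ S l i k G (CG k)); first exact: overlap_open.
    move=> y /[!inE] /overlapP[ly iy].
    by rewrite /= transitionE /f asboolT.
  have nKx : ~ K (cinv (atlas l) x) by move=> /KP[].
  exists (interior [set y | ~ K (cinv (atlas l) y)]).
    have N : nbhs (cinv (atlas l) x) (~` K).
      by apply: open_nbhs_nbhs; split=> //; exact: closed_openC.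
    exact: (cinv_continuous_at lx N).
  apply: (@eq_Ck _ _ _ (fun=> 0)); [exact: open_interior| |exact: Ck_cst].
  by move=> y /[!inE] /interior_subset /= /fK.
- move=> p [ip [b bs pb]]; apply: (PK p b) => //.
  have := (sO _ _ bs).1; move: pb; clear; move=> *; lra.
- move=> p [ip [b bs pb]]; rewrite /f asboolT// /G (cutoff1 bs (ltW pb)) mul1r//.
Qed.

(** An open set on which the function F, read in the chart, meets the
    requirements of the theorem with constants that are uniform on the set. *)
Definition good_patch U i (F : R * R -> R) (c : R) :=
  [/\ open U, U `<=` cdom (atlas i), (vol U < +oo)%E, Cinfty setT F &
   0 < c /\ forall p, U p -> let x := cmap (atlas i) p in
     pinched (metric i x) (hessian i F x) /\
     c <= form_eval (metric i x) (gradient i F x) (gradient i F x)].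

Lemma good_patch_exists (p : M) : exists U, U p /\ exists i F c, good_patch U i F c.
Proof.
pose i := chart_at S p; pose y := cmap (atlas i) p.
have iy : cimg (atlas i) y by exact/cimg_cmap/cdom_chart_at.
have [r [x0 [c [L [r0 c0 H]]]]] := pinched_quadratic_near iy.
pose U : set M := [set q | cdom (atlas i) q /\ `|cmap (atlas i) q - y| < r].
have oU : open U.
  rewrite openE => q [iq qy].
  have B : nbhs (cmap (atlas i) q) [set x | `|x - y| < r].
    apply: open_nbhs_nbhs; split=> //.
    have -> : [set x | `|x - y| < r] = ball y r.
      by apply/seteqP; split=> x; rewrite -ball_normE /ball_/= distrC.
    exact: ball_open.
  have N : \forall q' \near q, `|cmap (atlas i) q' - y| < r.
    exact: (cmap_continuous_at iq B).
  by apply: filterS2 N (near_cdom iq) => q' qy' iq'; split.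
have Ui : U `<=` cdom (atlas i) by move=> q [].
exists U; split; first by split; [exact: cdom_chart_at|rewrite subrr normr0].
exists i, (quadratic (metric i y) x0), c; split=> //.
- apply: (finite_volume vol_riemannian oU Ui (y := y) (r := r) (L := L)) => q [iq qy].
  by split; [exact: ltW|have [] := H _ qy].
- by move=> k; apply: Ck_quadratic; exact: openT.
- by split=> // q [iq qy]; have [] := H _ qy.
Qed.

Lemma smoothD f f' : smooth S f -> smooth S f' -> smooth S (fun p => f p + f' p).
Proof.
move=> sf sf' i k; have oi : open (cimg (atlas i)) by exact: cimg_open.
exact: CkD oi (sf i k) (sf' i k).
Qed.

(** The part of the new patch U q that lies in K needs no care: K is contained in
    the patches already treated, and what V misses there has been counted. *)
Lemma exhausting_function (U : M -> set M) (l : seq M) (e : R) :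
  (forall q, exists i F c, good_patch (U q) i F c) -> 0 < e ->
  let A := [set p | exists2 q, q \in l & U q p] in
  exists f V K c,
    [/\ [/\ smooth S f, open V, closed K, V `<=` K & K `<=` A],
        0 < c, forall p, ~ K p -> f p = 0,
        forall p, V p -> pinched_in (chart_at S p) f p /\ c <= sqgrad S f p &
        (vol (A `\` V) <= e%:E)%E].
Proof.
move=> gU; elim: l e => [|q l IH] e e0 /=.
  exists (fun=> 0), set0, set0, 1; split=> //; first split=> //.
  - by move=> i k; exact: Ck_cst.
  - exact: open0.
  - exact: closed0.
  rewrite (_ : _ `\` _ = set0) ?measure0 ?lee_fin ?ltW//.
  by apply/seteqP; split=> p // -[[]].
have e20 : 0 < e / 2 by rewrite divr_gt0.
have [f [V [K [c [[sf oV clK VK KA] c0 f0 fV volV]]]]] := IH _ e20.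
set A := [set p | exists2 q, q \in l & U q p] in KA volV.
set A' := [set p | _].
have [i [F [c' [oU Ui Uoo CF [c'0 FU]]]]] := gU q.
pose W := U q `&` ~` K.
have oW : open W by apply: openI => //; exact: closed_openC.
have Woo : (vol W < +oo)%E.
  apply: le_lt_trans Uoo; apply: le_measure; rewrite ?inE; last exact: subIsetl.
  - exact: open_measurable_borel.
  - exact: open_measurable_borel.
have Wi : W `<=` cdom (atlas i) by move=> p [/Ui].
have [f' [V' [K' [[sf' oV' clK' V'K' K'W] f'0 f'V' volV']]]] := local_piece oW Wi Woo CF e20.
have sff' := smoothD sf sf'.
have near0 (g : M -> R) (L : set M) p : closed L -> (forall p, ~ L p -> g p = 0) -> ~ L p ->
    \forall q \near p, g q = 0.
  move=> clL g0 nLp.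
  have N : nbhs p (~` L) by apply: open_nbhs_nbhs; split=> //; exact: closed_openC.
  by apply: filterS N => p' /g0.
exists (fun p => f p + f' p), (V `|` V'), (K `|` K'), (Num.min c c').
have AA' : A `<=` A' by move=> p [q' q'l Up]; exists q' => //; rewrite inE q'l orbT.
have oA : open A.
  have -> : A = \bigcup_(q' in [set` l]) U q' by [].
  by apply: bigcup_open => q' _; have [? [? [? []]]] := gU q'.
split.
- split=> //; [exact: openU|exact: closedU| |].
  + by move=> p [/VK|/V'K']; [left|right].
  + by move=> p [/KA/AA'//|/K'W[Up _]]; exists q => //; rewrite inE eqxx.
- by rewrite lt_min c0.
- by move=> p nKp; rewrite f0 ?f'0 ?addr0// => ?; apply: nKp; [right|left].
- move=> p [Vp|V'p].
    (* On V the new summand vanishes nearby; on V' the old one does. *)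
    have nK'p : ~ K' p by move=> /K'W[_]; apply; exact: VK.
    have N : \forall p' \near p, f p' = f p' + f' p'.
      by apply: filterS (near0 _ _ _ clK' f'0 nK'p) => p' ->; rewrite addr0.
    have [fp fc] := fV p Vp; have cp := cdom_chart_at S p.
    split; first exact: near_pinched_in N fp.
    by rewrite sqgradE -(near_sqgrad_in cp N) ge_min fc.
  have [Up nKp] := K'W _ (V'K' _ V'p).
  have ip := Ui p Up; have cp := cdom_chart_at S p.
  have N : \forall x \near cmap (atlas i) p, F x = f (cinv (atlas i) x) + f' (cinv (atlas i) x).
    have N1 := near_cinv ip (near0 _ _ _ clK f0 nKp).
    have N2 := near_cinv ip (open_nbhs_nbhs (conj oV' V'p)).
    apply: filterS3 N1 N2 (near_cimg (cimg_cmap ip)) => x -> V'x ix.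
    by rewrite add0r (f'V' _ V'x) cinvK.
  have [Fp Fc] := FU p Up.
  split.
    apply: (pinched_in_change sff' cp ip).
    by rewrite /pinched_in -(near_hessian i N).
  rewrite sqgradE (sqgrad_in_change sff' cp ip) /sqgrad_in -(near_gradient i N).
  by rewrite ge_min Fc orbT.
- have -> : e = e / 2 + e / 2 by rewrite -splitr.
  have mB (B C : set M) : open B -> open C -> measurable (B `\` C : set (borel M)).
    by move=> oB oC; apply: measurableD; exact: open_measurable_borel.
  rewrite EFinD; apply: (@le_trans _ _ (vol ((A `\` V) `|` (W `\` V')))).
    apply: le_measure; rewrite ?inE.
    + apply: mB; last exact: openU.
      have -> : A' = \bigcup_(q' in [set` q :: l]) U q' by [].
      by apply: bigcup_open => q' _; have [? [? [? []]]] := gU q'.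
    + by apply: measurableU; exact: mB.
    move=> p [A'p nVp]; have [Ap|nAp] := pselect (A p).
      by left; split=> // Vp; apply: nVp; left.
    right; split; last by move=> V'p; apply: nVp; right.
    split; last by move=> /KA.
    case: A'p => q'; rewrite inE => /orP[/eqP ->//|q'l Up].
    by case: nAp; exists q'.
  apply: (@le_trans _ _ (vol (A `\` V) + vol (W `\` V'))%E); last exact: leeD.
  by apply: measureU2; exact: mB.
Qed.

End pieces.

Unset Implicit Arguments.

Theorem theorem4p2 (R : realType) (M : ptopologicalType)
    (S : riemannian_surface R M) (M_compact : compact [set: M])
    (vol : {measure set (borel M) -> \bar R})
    (vol_riemannian : riemannian_measure S vol)
    (eps : R) (eps_gt0 : 0 < eps) :
  exists (f : M -> R) (V : set M) (C alpha : R),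
    [/\ smooth S f, open V, 0 < C &
     [/\ (vol [set: M] - eps%:E <= vol V)%E,
         (0 < ereal_inf [set (normgrad S f x)%:E | x in V])%E &
         forall (T : R) (u : M -> R -> R), 0 < T -> C1_cylinder S T u ->
           (C%:E * \int[lebesgue_measure]_(t in `[0%R, T]) \int[vol]_(x in V)
              (sqgrad S (u ^~ t) x + time_deriv T (u x) t ^+ 2)%:E
            <= \int[lebesgue_measure]_(t in `[0%R, T]) \int[vol]_(x in V)
              (hess_grad S f (u ^~ t) x
               + (alpha - laplace_beltrami S f x / 2) * sqgrad S (u ^~ t) x
               + (laplace_beltrami S f x / 2 - alpha)
                 * time_deriv T (u x) t ^+ 2)%:E)%E]].
Proof.
have [U HU] := choice (good_patch_exists vol_riemannian).
have gU q := (HU q).2.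
have [l lU] : exists l : seq M, [set: M] `<=` [set p | exists2 q, q \in l & U q p].
  move: M_compact; rewrite compact_cover cover_compactE => /(_ M setT U).
  case=> [|q _|D _ DU].
  - by exists U => [q _|q _]; [have [? [? [? []]]] := gU q|rewrite setTI].
  - by exists q => //; exact: (HU q).1.
  by exists (finmap.enum_fset D) => q /DU[q' Dq' Uq]; exists q'.
have [f [V [K [c [[sf oV _ _ _] c0 _ fV volV]]]]] :=
  exhausting_function l gU eps_gt0.
exists f, V, (1 / 4), (1 / 2); split=> //; split.
- have E : [set p | exists2 q, q \in l & U q p] = [set: M] by apply/seteqP; split.
  rewrite {}E in volV.
  have mV : measurable (V : set (borel M)) by exact: open_measurable_borel.
  have mVC : measurable ([set: M] `\` V : set (borel M)).
    by apply: measurableD => //; exact: measurableT.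
  rewrite leeBlDr//; apply: (@le_trans _ _ (vol V + vol ([set: M] `\` V))%E).
    apply: le_trans (measureU2 _ mV mVC).
    apply: le_measure; rewrite ?inE; [exact: measurableT|exact: measurableU|].
    by move=> p _; have [] := pselect (V p); [left|right].
  exact: leeD.
- apply: (@lt_le_trans _ _ (Num.sqrt c)%:E); first by rewrite lte_fin sqrtr_gt0.
  apply: le_ereal_inf_tmp => _ [p Vp <-].
  by rewrite lee_fin ler_wsqrtr//; have [] := fV p Vp.
- move=> T u T0 _; apply: iterated_integral_le => // t x _ Vx.
    by rewrite addr_ge0 ?sqr_ge0// sqgrad_ge0.
  by apply: carleman_pointwise; have [] := fV x Vx.
Qed.
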